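(* Let $X$ be a regular connected graph and $S$ a set of marked vertices with $|S|\ge2$, such that $S$ has walk-equitable neighborhoods in $X\setminus S$. Then $\widehat M[S,S]$ is uniform (a scalar multiple of the all-ones matrix) if and only if all of the following hold: (i) $|S|=2$; (ii) $X$ is either an odd cycle or a bipartite graph; (iii) the vertices of $S$ are neighborhood-strongly-cospectral in $X\setminus S$.
   Context: $X$ is $k$-regular. Walk: arcs are ordered pairs $(u,v)$ of adjacent vertices; $R$ the arc-reversal matrix; $D_t$ the tail incidence matrix ($(D_t)_{x,(u,v)}=1$ iff $x=u$); $O_S$ the identity with $[S,S]$ block zeroed; $U=R(\frac2kD_t^TO_SD_t-I)$. Average vertex mixing matrix: $\widehat M_{u,v}=\lim_{T\to\infty}\frac1T\sum_{t=0}^{T-1}\sum_{w\sim u}|(U^tx_v)_{(u,w)}|^2$, $x_v=k^{-1/2}D_t^Te_v$. $S$ has walk-equitable neighborhoods in $X\setminus S$ if for every $m\ge0$ and all $a,b\in S$, the number of walks of length $m$ in $X\setminus S$ from a vertex $u\in N(a)\setminus S$ to $N(b)\setminus S$ is independent of the choice of $u\in N(a)\setminus S$. Write $H=A[S,\overline S]$ where $\overline S=V\setminus S$. Two vertices $a,b\in S$ are neighborhood-strongly-cospectral in $X\setminus S$ if $G_rH^Te_a=\pm G_rH^Te_b$ for every eigenprojection $G_r$ of $A(X\setminus S)$ (i.e., the characteristic vectors of $N(a)\setminus S$ and $N(b)\setminus S$ are strongly cospectral). *)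

(* Defs.v *)
From HB Require Import structures.
From mathcomp Require Import all_boot all_order all_algebra.
From mathcomp Require Import all_classical all_reals all_analysis.

Set Implicit Arguments.
Unset Strict Implicit.
Unset Printing Implicit Defensive.

Import Order.TTheory GRing.Theory Num.Theory.
Import numFieldNormedType.Exports.

Local Open Scope ring_scope.

(* A finite simple graph is a symmetric irreflexive relation [e] on a finite
   type [V] of vertices. *)
Section Graph.
Context (V : finType) (e : rel V).

Definition nbhd (x : V) : {set V} := [set y | e x y].

Definition regular_graph (k : nat) : Prop := forall x, #|nbhd x| = k.

Definition connected_graph : Prop := forall x y, connect e x y.

Definition bipartite_graph : Prop :=
  exists B : {set V}, forall x y, e x y -> (x \in B) != (y \in B).

Definition odd_cycle_graph : Prop :=
  exists (n : nat) (f : 'I_n -> V),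
    [/\ odd n, (2 < n)%N, bijective f &
        forall i j : 'I_n, e (f i) (f j) =
          (i.+1 == j %[mod n])%N || (j.+1 == i %[mod n])%N].

Definition arcs : {set V * V} := [set p | e p.1 p.2].

(* The walk visiting u, p_0, ..., p_(m-1) has length m. *)
Definition nb_walks_avoiding (S : {set V}) (m : nat) (u : V) (T : {set V}) :
    nat :=
  #|[set p : m.-tuple V |
      [&& path e u p, all (fun x => x \notin S) (u :: p) & last u p \in T]]|.

Definition walk_equitable_nbhds (S : {set V}) : Prop :=
  forall (m : nat) (a b : V), a \in S -> b \in S ->
  forall u u' : V, u \in nbhd a :\: S -> u' \in nbhd a :\: S ->
    nb_walks_avoiding S m u (nbhd b :\: S) =
    nb_walks_avoiding S m u' (nbhd b :\: S).

End Graph.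

Section IndexedMatrices.
Context (R : realType) (I J : finType).

Definition mx_on (P : {set I}) (Q : {set J}) (f : I -> J -> R) :
    'M[R]_(#|P|, #|Q|) :=
  \matrix_(i, j) f (enum_val i) (enum_val j).

Definition std_vec (P : {set I}) (a : I) : 'cV[R]_#|P| :=
  \col_i (enum_val i == a)%:R.

End IndexedMatrices.

(* G is the orthogonal projector onto an eigenspace of A, meant for symmetric A:
   [eigenspace] and [:=:] are about row spaces, but A and G being symmetric, G
   also projects onto the column eigenspace. *)
Definition is_eigenprojection (R : realType) (n : nat) (A G : 'M[R]_n) :
    Prop :=
  exists2 theta : R, eigenvalue A theta &
    [/\ G^T = G, G *m G = G & (G :=: eigenspace A theta)%MS].

Section Walk.
Context (R : realType) (V : finType) (e : rel V) (k : nat) (S : {set V}).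

Definition adj_block (P Q : {set V}) : 'M[R]_(#|P|, #|Q|) :=
  mx_on P Q (fun x y => (e x y)%:R).

Definition arc_reversal : 'M[R]_#|arcs e| :=
  mx_on (arcs e) (arcs e) (fun p q => (q == (p.2, p.1))%:R).

Definition tail_incidence : 'M[R]_(#|[set: V]|, #|arcs e|) :=
  mx_on [set: V] (arcs e) (fun x p => (x == p.1)%:R).

(* O_S: the identity matrix with its [S,S] block zeroed. *)
Definition oracle : 'M[R]_#|[set: V]| :=
  mx_on [set: V] [set: V]
    (fun x y => if (x \in S) && (y \in S) then 0 else (x == y)%:R).

Definition walk_mx : 'M[R]_#|arcs e| :=
  arc_reversal *m
    ((2 / k%:R) *: (tail_incidence^T *m oracle *m tail_incidence) - 1%:M).

Definition vertex_state (v : V) : 'cV[R]_#|arcs e| :=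
  (Num.sqrt k%:R)^-1 *: (tail_incidence^T *m std_vec R [set: V] v).

Definition mixing_prob (t : nat) (u v : V) : R :=
  \sum_(p < #|arcs e| | (enum_val p).1 == u)
    `|(walk_mx ^+ t *m vertex_state v) p ord0| ^+ 2.

Definition avg_vertex_mixing (u v : V) : R :=
  limn (fun T : nat => T%:R^-1 * \sum_(t < T) mixing_prob t u v).

Definition nbhd_strongly_cospectral (a b : V) : Prop :=
  let H := adj_block S (~: S) in
  forall G : 'M[R]_#|~: S|, is_eigenprojection (adj_block (~: S) (~: S)) G ->
    G *m H^T *m std_vec R S a = G *m H^T *m std_vec R S b \/
    G *m H^T *m std_vec R S a = - (G *m H^T *m std_vec R S b).

End Walk.

(* Main.v *)
(* Let [Y] be the subgraph induced on the unmarked vertices, with spectral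
   idempotents [G_t], [|t| < k].  On arcs leaving a marked vertex, the walk
   started at [v] is an explicit combination of the sequences [1], [(-1)^n] and
   [cos (n acos (t / k))] with coefficients read off [G_t H^T e_v], so averaging
   its square over time leaves, by orthogonality of these sequences,
   [4 k Mhat_uv] = the sum over the neighbors [z] of [u] of
   [(d_uv - d_zv - a_v z)^2 + (d_uv + d_zv - b_v z)^2
    + 2 sum_t (k / (k^2 - t^2) (G_t H^T e_v) z)^2],
   where [d] is the Kronecker delta, [a_v = (k - A_Y)^-1 H^T e_v] (the
   probability that a random walk enters [S] at [v]) and
   [b_v = (k + A_Y)^-1 H^T e_v].  Equitability makes [a_v], [b_v] and
   [G_t H^T e_v] constant on each [N(u) \ S].
   If the matrix is uniform, [Mhat_uu + Mhat_vv - 2 Mhat_uv = 0] is a sum of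
   nonnegative terms (Cauchy-Schwarz for the [G_t], the maximum principle
   [|b| <= a] and [sum_v a_v = 1] for the others); their vanishing gives
   strong cospectrality, excludes a third marked vertex, and forces
   [b_u + b_v] or [b_u - b_v] to be a sign everywhere on [Y], i.e. deleting the
   edges inside [S] makes the graph bipartite.  If [u] and [v] are adjacent and
   of the same color, counting edges gives [k = 2] and an odd cycle. *)
Require Import Defs.
From HB Require Import structures.
From mathcomp Require Import all_boot all_order all_algebra.
From mathcomp Require Import spectral complex ring lra.
From mathcomp Require Import all_classical all_reals all_analysis.

Set Implicit Arguments.
Unset Strict Implicit.
Unset Printing Implicit Defensive.

Import Order.TTheory GRing.Theory Num.Theory.
Import numFieldNormedType.Exports.

Local Open Scope ring_scope.

(** * Eigenprojections of real symmetric matrices *)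

(** Over the complex numbers the spectral theorem conjugates [A] to a diagonal matrix with real
    entries. The product of the factors [X - t] over these entries kills it, and the identity
    descends because base change of matrices is injective. *)
Lemma real_sym_annihilator (R : rcfType) (n : nat) (A : 'M[R]_n.+1) :
  A^T = A ->
  exists2 s : seq R, uniq s & horner_mx A (\prod_(t <- s) ('X - t%:P)) = 0.
Proof.
move=> A_sym; pose toC := real_complex R.
pose B := map_mx toC A.
have B_herm : B \is hermsymmx.
  apply: realsym_hermsym.
    apply/is_hermitianmxP; rewrite expr0 scale1r.
    by apply/matrixP => i j; rewrite !mxE -[in LHS]A_sym mxE.
  by apply/mxOverP => i j; rewrite mxE complex_real.
have /orthomx_spectralP B_eq := hermitian_normalmx B_herm.
have sp_real := hermitian_spectral_diag_real B_herm.
set P := spectralmx B in B_eq; set sp := spectral_diag B in B_eq sp_real.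
have sp_re j : sp ord0 j = toC (complex.Re (sp ord0 j)).
  by rewrite /toC RRe_real // (mxOverP sp_real).
(* Removing repetitions leaves distinct roots, as Lagrange interpolation requires. *)
pose s := undup [seq complex.Re (sp ord0 j) | j : 'I_n.+1].
exists s; first exact: undup_uniq.
apply: (map_mx_inj (f := toC)); rewrite map_mx0 map_horner_mx -/B B_eq.
have Pu : P \in unitmx by exact: spectral_unit.
rewrite horner_mx_uconjC //.
rewrite horner_mx_diag; set D := diag_mx _.
suff -> : D = 0 by rewrite mulmx0 mul0mx.
rewrite /D; apply/matrixP => i j; rewrite !mxE.
case: eqVneq => [_|]; last by rewrite mulr0n.
rewrite mulr1n rmorph_prod horner_prod sp_re.
have : complex.Re (sp ord0 i) \in s.
  by rewrite mem_undup; apply/mapP; exists i; rewrite ?mem_enum.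
move=> /(bigD1_seq _) -> /=; last exact: undup_uniq.
by rewrite map_polyXsubC hornerXsubC subrr mul0r.
Qed.

(** * Lagrange interpolation at distinct nodes *)

Section Lagrange.
Variables (R : fieldType) (s : seq R).
Hypothesis s_uniq : uniq s.

Definition lagrange_basis (t : R) : {poly R} :=
  \prod_(x <- s | x != t) ((t - x)^-1 *: ('X - x%:P)).

Lemma lagrange_basis_eval t x : t \in s -> x \in s ->
  (lagrange_basis t).[x] = (x == t)%:R.
Proof.
move=> ts xs; rewrite horner_prod; case: eqVneq => [->|x_neq].
  rewrite big1 // => y y_neq; rewrite hornerZ hornerXsubC mulVf //.
  by rewrite subr_eq0 eq_sym.
rewrite (big_rem x) //= x_neq.
by rewrite hornerZ hornerXsubC subrr mulr0 mul0r.
Qed.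

Lemma size_lagrange_basis t : t \in s -> (size (lagrange_basis t) <= size s)%N.
Proof.
move=> ts; rewrite /lagrange_basis.
have -> : \prod_(x <- s | x != t) ((t - x)^-1 *: ('X - x%:P)) =
    (\prod_(x <- s | x != t) (t - x)^-1)%:P *
    \prod_(x <- rem t s) ('X - x%:P).
  rewrite rem_filter // big_filter rmorph_prod -big_split /=.
  by apply: eq_bigr => x _; rewrite mul_polyC.
rewrite mul_polyC (leq_trans (size_scale_leq _ _)) //.
rewrite size_prod_XsubC size_rem //.
by case: (s) ts.
Qed.

(** The difference of the two sides has size at most [size s] and vanishes at every node. *)
Lemma sum_lagrange_basis : (0 < size s)%N ->
  \sum_(t <- s) lagrange_basis t = 1.
Proof.
move=> s_gt0; apply/eqP; rewrite -subr_eq0; apply/eqP.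
apply: (@roots_geq_poly_eq0 _ _ s) => //.
  apply/allP => x xs; rewrite /root !hornerE horner_sum.
  rewrite (bigD1_seq x) //= lagrange_basis_eval // eqxx big_seq_cond big1 ?addr0 ?subrr //.
  move=> t /andP[ts t_neq]; rewrite lagrange_basis_eval // eq_sym.
  by rewrite (negbTE t_neq).
rewrite (leq_trans (size_polyD _ _)) // geq_max size_polyN size_poly1 s_gt0 andbT.
rewrite (leq_trans (size_sum _ _ _)) //; rewrite big_seq.
elim/big_ind: _ => // [x y xs ys|t ts]; first by rewrite geq_max xs ys.
exact: size_lagrange_basis.
Qed.

(** Evaluated at a matrix killed by the full product, this becomes the eigenvector equation for the
    image of [lagrange_basis t]. *)
Lemma mul_XsubC_lagrange_basis t : t \in s ->
  exists c : R, ('X - t%:P) * lagrange_basis t =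
    c *: \prod_(x <- s) ('X - x%:P).
Proof.
move=> ts; exists (\prod_(x <- s | x != t) (t - x)^-1).
rewrite (bigD1_seq t) //= -mul_polyC rmorph_prod /= mulrCA -big_split /=.
by congr (_ * _); apply: eq_bigr => x _; rewrite mul_polyC.
Qed.

End Lagrange.

(** Nonzero projections ensure that [s] lists eigenvalues only. For symmetric [A], mutual
    orthogonality of the [G t] follows from the eigenvector equations at distinct [t]. *)
Definition eigen_decomposition (R : realFieldType) (n : nat) (A : 'M[R]_n)
    (s : seq R) (G : R -> 'M[R]_n) : Prop :=
  [/\ uniq s,
      forall t, t \in s -> G t != 0,
      forall t, t \in s ->
        [/\ (G t)^T = G t, G t *m G t = G t & A *m G t = t *: G t] &
      \sum_(t <- s) G t = 1%:M].

(* The last clause says that each projection lies in the algebra generated by [A]. *)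
Lemma real_sym_eigen_decomposition (R : rcfType) (n : nat) (A : 'M[R]_n) :
  A^T = A ->
  exists s : seq R, exists G : R -> 'M[R]_n,
    eigen_decomposition A s G /\
    forall (t : R) (K : 'cV[R]_n -> Prop),
      (forall a b x y, K x -> K y -> K (a *: x + b *: y)) ->
      (forall x, K x -> K (A *m x)) ->
      forall x, K x -> K (G t *m x).
Proof.
case: n A => [|n] A A_sym.
  (* For matrices of size 0 the empty sum is already the identity. *)
  exists [::], (fun=> 1%:M); split; last by move=> t K _ _ x Kx; rewrite mul1mx.
  by split=> //; apply/matrixP; case.
have [s s_uniq s_ann] := real_sym_annihilator A_sym.
have s_gt0 : (0 < size s)%N.
  case: s s_ann {s_uniq} => // /eqP.
  by rewrite big_nil rmorph1 oner_eq0.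
pose G t := horner_mx A (lagrange_basis s t).
have tr_horner p : (horner_mx A p)^T = horner_mx A p.
  rewrite -[p]coefK poly_def rmorph_sum /= linear_sum /=; apply: eq_bigr => i _.
  rewrite linearZ /= linearZ /=; congr (_ *: _).
  rewrite rmorphXn /= horner_mx_X.
  elim: (nat_of_ord i) => [|m IH]; first by rewrite !expr0 trmx1.
  by rewrite exprS trmx_mul IH A_sym -[in RHS]exprS exprSr.
have AG t : t \in s -> A *m G t = t *: G t.
  move=> ts; have [c /(congr1 (horner_mx A))] := mul_XsubC_lagrange_basis s_uniq ts.
  rewrite linearZ /= s_ann scaler0 rmorphM rmorphB /= horner_mx_X horner_mx_C.
  by rewrite mulrBl => /eqP; rewrite subr_eq0 => /eqP; rewrite -mul_scalar_mx.
have sumG : \sum_(t <- s) G t = 1%:M.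
  by rewrite -rmorph_sum /= sum_lagrange_basis // rmorph1.
have GG t x : t \in s -> x \in s -> t != x -> G t *m G x = 0.
  move=> ts xs t_neq.
  have E : t *: (G t *m G x) = x *: (G t *m G x).
    rewrite scalemxAl -AG // scalemxAr -AG // !mulmxA; congr (_ *m _).
    exact: (comm_mx_horner _ (comm_mx_refl A)).
  apply/eqP; move/eqP: E; rewrite -subr_eq0 -scalerBl scaler_eq0.
  by rewrite subr_eq0 (negbTE t_neq).
(* The annihilator is not known to have only eigenvalues as roots, so the roots with zero projection
   are discarded. *)
exists [seq t <- s | G t != 0], G; split; last first.
  move=> t K K_lin KA x Kx; rewrite /G; elim/poly_ind: (lagrange_basis s t) => [|p c IH].
    rewrite rmorph0 mul0mx; have := K_lin 0 0 _ _ Kx Kx.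
    by rewrite !scale0r addr0.
  rewrite rmorphD rmorphM /= horner_mx_X horner_mx_C.
  rewrite [_ * A](comm_horner_mx _ (comm_mx_refl A)) mulmxDl -mulmxA mul_scalar_mx.
  by have := K_lin 1 c _ _ (KA _ IH) Kx; rewrite scale1r.
split; first exact: filter_uniq.
- by move=> t; rewrite mem_filter => /andP[].
- move=> t; rewrite mem_filter => /andP[_ ts]; split; [exact: tr_horner | | exact: AG].
  rewrite -[in RHS](mulmx1 (G t)) -sumG mulmx_sumr (bigD1_seq t) //=.
  rewrite big_seq_cond big1 ?addr0 // => x /andP[xs x_neq]; apply: GG => //.
  by rewrite eq_sym.
rewrite big_filter -[RHS]sumG [RHS](bigID (fun t => G t != 0)) /=.
rewrite [X in _ = _ + X]big1 ?addr0 // => t /negPn/eqP //.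
Qed.

(** Distinct eigenvalues give [P *m G x = 0] for [x != t], hence [P = P *m G t]. The rows of [G t]
    lie in the row space of [P], hence [G t *m P = G t]. Transposition identifies the two. *)
Lemma eigen_decomposition_unique (R : realType) (n : nat) (A : 'M[R]_n)
    (s : seq R) (G : R -> 'M[R]_n) (P : 'M[R]_n) :
  A^T = A -> eigen_decomposition A s G -> is_eigenprojection A P ->
  exists2 t, t \in s & P = G t.
Proof.
move=> A_sym [s_uniq G_neq0 G_proj sumG] [t t_eig [P_sym P_idem P_eig]].
have PA : P *m A = t *: P by apply/eigenspaceP; rewrite P_eig.
have GA x : x \in s -> G x *m A = x *: G x.
  move=> xs; have [G_sym _ AG] := G_proj _ xs.
  by rewrite -{1}G_sym -{1}A_sym -trmx_mul AG linearZ /= G_sym.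
have PG x : x \in s -> x != t -> P *m G x = 0.
  move=> xs x_neq; have [_ _ AG] := G_proj _ xs.
  have : t *: (P *m G x) = x *: (P *m G x).
    by rewrite scalemxAl -PA -mulmxA AG scalemxAr.
  move/eqP; rewrite -subr_eq0 -scalerBl scaler_eq0 subr_eq0 eq_sym (negbTE x_neq).
  by move/eqP.
have P_neq0 : P != 0.
  apply: contraTneq t_eig => P0; rewrite /eigenvalue negbK.
  by rewrite -submx0 -P_eig P0 submx0.
have ts : t \in s.
  apply: contraNT P_neq0 => tNs; rewrite -(mulmx1 P) -sumG mulmx_sumr.
  rewrite big_seq big1 // => x xs; apply: PG => //.
  by apply: contraNneq tNs => <-.
have PE : P = P *m G t.
  rewrite -[LHS](mulmx1 P) -sumG mulmx_sumr (bigD1_seq t) //= big_seq_cond big1 ?addr0 //.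
  by move=> x /andP[xs x_neq]; exact: PG.
have [G_sym _ _] := G_proj _ ts.
exists t => //.
have GP : G t *m P = G t.
  have : (G t <= P)%MS by rewrite P_eig; apply/eigenspaceP; exact: GA.
  by move=> /submxP[X ->]; rewrite -mulmxA P_idem.
by rewrite -P_sym PE trmx_mul P_sym G_sym GP.
Qed.

(** The eigenspace of [t] is annihilated by every other projection, so multiplication by [G t] fixes
    it and it lies in the row space of [G t]. *)
Lemma eigen_decomposition_eigenprojection (R : realType) (n : nat)
    (A : 'M[R]_n) (s : seq R) (G : R -> 'M[R]_n) (t : R) :
  A^T = A -> eigen_decomposition A s G -> t \in s -> is_eigenprojection A (G t).
Proof.
move=> A_sym [s_uniq G_neq0 G_proj sumG] ts.
have GA x : x \in s -> G x *m A = x *: G x.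
  move=> xs; have [G_sym _ AG] := G_proj _ xs.
  by rewrite -{1}G_sym -{1}A_sym -trmx_mul AG linearZ /= G_sym.
have [G_sym G_idem AG] := G_proj _ ts.
have G_sub : (G t <= eigenspace A t)%MS by apply/eigenspaceP; exact: GA.
exists t.
  apply: contraNneq (G_neq0 _ ts) => E0.
  by rewrite -submx0 -E0.
split=> //; apply/eqmxP; rewrite G_sub /=.
set E := eigenspace A t.
have EA : E *m A = t *: E by apply/eigenspaceP.
suff -> : E = E *m G t by apply: submxMl.
rewrite -[LHS](mulmx1 E) -sumG mulmx_sumr (bigD1_seq t) //= big_seq_cond big1 ?addr0 //.
move=> x /andP[xs x_neq]; have [_ _ AGx] := G_proj _ xs.
have : t *: (E *m G x) = x *: (E *m G x).
  by rewrite scalemxAl -EA -mulmxA AGx scalemxAr.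
move/eqP; rewrite -subr_eq0 -scalerBl scaler_eq0 subr_eq0 eq_sym (negbTE x_neq).
by move/eqP.
Qed.

(** * Cesaro means of products of Chebyshev sequences *)

Section CesaroMean.
Local Open Scope classical_set_scope.
Local Open Scope ring_scope.
Variable R : realType.
Implicit Types (f g : nat -> R) (l m x y : R).

Definition has_mean f l : Prop :=
  (fun T : nat => T%:R^-1 * \sum_(t < T) f t) @ \oo --> l.

Lemma eq_has_mean f g l : f =1 g -> has_mean f l -> has_mean g l.
Proof. by move=> /funext ->. Qed.

Lemma has_meanD f g l m :
  has_mean f l -> has_mean g m -> has_mean (fun t => f t + g t) (l + m).
Proof.
move=> fl gm; rewrite /has_mean.
under eq_fun do rewrite big_split mulrDr.
exact: cvgD.
Qed.

Lemma has_meanZ f l a : has_mean f l -> has_mean (fun t => a * f t) (a * l).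
Proof.
move=> fl; rewrite /has_mean.
under eq_fun do rewrite -mulr_sumr mulrCA.
by apply: cvgM => //; exact: cvg_cst.
Qed.

Lemma has_mean_sum (I : Type) (r : seq I) (F : I -> nat -> R) (L : I -> R) :
  (forall i, has_mean (F i) (L i)) ->
  has_mean (fun t => \sum_(i <- r) F i t) (\sum_(i <- r) L i).
Proof.
move=> FL; elim: r => [|i r IH].
  rewrite big_nil; apply: (@eq_has_mean (fun=> 0)) => [t|]; first by rewrite big_nil.
  rewrite /has_mean; under eq_fun do rewrite big1 ?mulr0 //.
  exact: cvg_cst.
rewrite big_cons; apply: eq_has_mean (has_meanD (FL i) IH) => t.
by rewrite big_cons.
Qed.

Lemma has_mean_sum_seq (I : eqType) (r : seq I) (F : I -> nat -> R) (L : I -> R) :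
  {in r, forall i, has_mean (F i) (L i)} ->
  has_mean (fun t => \sum_(i <- r) F i t) (\sum_(i <- r) L i).
Proof.
move=> FL; rewrite big_seq big_mkcond.
apply: (@eq_has_mean (fun t => \sum_(i <- r) if i \in r then F i t else 0)).
  by move=> t; rewrite -big_mkcond -big_seq.
apply: has_mean_sum => i; case: ifP => [/FL //|_].
rewrite /has_mean; under eq_fun do rewrite big1 ?mulr0 //.
exact: cvg_cst.
Qed.

Lemma has_mean_cst l : has_mean (fun=> l) l.
Proof.
(* The average over [T = 0] terms is 0 rather than [l], so the averages are constant only from
   [T = 1] on. *)
apply: (@cvg_trans _ ((fun=> l) @ \oo)); last exact: cvg_cst.
apply: near_eq_cvg; exists 1%N => // T /= T_gt0.
rewrite sumr_const card_ord -[X in _ * X]mulr_natl mulrA mulVf ?mul1r //.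
by rewrite pnatr_eq0 -lt0n.
Qed.

Lemma has_mean_bounded f C :
  (forall T : nat, `|\sum_(t < T) f t| <= C) -> has_mean f 0.
Proof.
move=> f_le; rewrite /has_mean -(@cvg_shiftS R).
have CV : (fun n : nat => C * harmonic n) @ \oo --> (0 : R).
  by rewrite -(mulr0 C); apply: cvgM; [exact: cvg_cst | exact: cvg_harmonic].
apply: (@squeeze_cvgr _ _ _ _ (fun n => - (C * harmonic n)) (fun n => C * harmonic n)) => //.
  near=> n; rewrite -ler_norml normrM ger0_norm ?invr_ge0 // mulrC.
  by apply: ler_wpM2r; rewrite ?invr_ge0.
by rewrite -oppr0; exact: cvgN.
Unshelve. all: by end_near.
Qed.

(* Telescoping the discrete Wronskian [u t.+1 * v t - u t * v t.+1]. *)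
Lemma has_mean_recurrence x y (u v : nat -> R) :
  x != y ->
  (forall t, `|u t| <= 1) -> (forall t, `|v t| <= 1) ->
  (forall t, u t.+2 = 2 * x * u t.+1 - u t) ->
  (forall t, v t.+2 = 2 * y * v t.+1 - v t) ->
  has_mean (fun t => u t * v t) 0.
Proof.
move=> xy u1 v1 uE vE.
pose W t := u t.+1 * v t - u t * v t.+1.
have uv1 i j : `|u i * v j| <= 1.
  by rewrite normrM -[leRHS]mulr1; apply: ler_pM.
have W2 t : `|W t| <= 2.
  by rewrite (le_trans (ler_normB _ _)) // -[2]/(1 + 1) lerD.
have WE T : 2 * (x - y) * \sum_(t < T) u t.+1 * v t.+1 = W T - W 0%N.
  elim: T => [|T IH]; first by rewrite big_ord0 mulr0 subrr.
  by rewrite big_ord_recr /= mulrDr IH /W uE vE; ring.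
have xy0 : 0 < `|x - y| by rewrite normr_gt0 subr_eq0.
(* The 1 bounds the term of index 0, which the telescoping omits. The other terms add up to
   [(W T - W 0) / (2 (x - y))], with both Wronskians bounded by 2. *)
apply: (@has_mean_bounded _ (1 + 2 / `|x - y|)) => -[|T].
  by rewrite big_ord0 normr0 addr_ge0 // divr_ge0.
rewrite big_ord_recl /= (le_trans (ler_normD _ _)) // lerD //.
rewrite ler_pdivlMr // -normrM mulrC.
have -> : (x - y) * (\sum_(i < T) u (bump 0 i) * v (bump 0 i)) = 2^-1 * (W T - W 0%N).
  by rewrite -WE; field.
rewrite normrM ger0_norm ?invr_ge0 // ler_pdivrMl // mulrC.
by rewrite (le_trans (ler_normB _ _)) // -[leRHS]/(2 * (1 + 1)) mulrDr mulr1 lerD.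
Qed.

(** For [x] in [[-1, 1]] this is the value at [x] of the Chebyshev polynomial of the first kind of
    degree [t]. *)
Definition cheb x (t : nat) : R := cos (t%:R * acos x).

(** The mean of the square of [cheb x]: at [x = 1] and [x = -1] the square is constantly 1,
    elsewhere in the interval it averages to one half. *)
Definition cheb_weight x : R := if x ^+ 2 == 1 then 1 else 2^-1.

Lemma cos_natSS (a : R) (t : nat) :
  cos (t.+2%:R * a) = 2 * cos a * cos (t.+1%:R * a) - cos (t%:R * a).
Proof.
have -> : t.+2%:R * a = t.+1%:R * a + a by rewrite -addn1 natrD mulrDl mul1r.
have -> : t%:R * a = t.+1%:R * a - a by rewrite -addn1 natrD mulrDl mul1r addrK.
by rewrite cosD cosB; ring.
Qed.

Lemma norm_cos_le1 (a : R) : `|cos a| <= 1.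
Proof. by rewrite ler_norml cos_geN1 cos_le1. Qed.

Lemma cheb0 x : cheb x 0 = 1.
Proof. by rewrite /cheb mul0r cos0. Qed.

Lemma cheb1 x : -1 <= x <= 1 -> cheb x 1 = x.
Proof. by move=> x1; rewrite /cheb mul1r acosK // in_itv. Qed.

Lemma chebSS x t : -1 <= x <= 1 -> cheb x t.+2 = 2 * x * cheb x t.+1 - cheb x t.
Proof. by move=> x1; rewrite /cheb cos_natSS acosK // in_itv. Qed.

Lemma cheb_at1 t : cheb 1 t = 1.
Proof. by rewrite /cheb acos1 mulr0 cos0. Qed.

Lemma cheb_atN1 t : cheb (-1) t = (-1) ^+ t.
Proof.
have N1 : -1 <= (-1 : R) <= 1 by apply/andP; split; lra.
elim/ltn_ind: t => -[|[|t]] IH; rewrite ?cheb0 ?cheb1 ?chebSS //.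
by rewrite !IH // !exprS; ring.
Qed.

Lemma has_mean_cheb_prod x y :
  -1 <= x <= 1 -> -1 <= y <= 1 -> x != y ->
  has_mean (fun t => cheb x t * cheb y t) 0.
Proof.
move=> x1 y1 xy; apply: (@has_mean_recurrence x y) => // t;
  by [exact: norm_cos_le1 | exact: chebSS].
Qed.

(** The half-angle formula leaves the mean of [cos (t * 2 a)], which is 1 if [x ^+ 2 = 1] and 0
    otherwise. *)
Lemma has_mean_cheb_sq x : -1 <= x <= 1 ->
  has_mean (fun t => cheb x t * cheb x t) (cheb_weight x).
Proof.
move=> x1; set a := acos x; have cosa : cos a = x by rewrite acosK // in_itv.
have cos2a : cos (2 * a) = 2 * x ^+ 2 - 1.
  by rewrite mulr_natl cos_mulr2n cosa mulr_natl.
have sqE t : 2^-1 + 2^-1 * cos (t%:R * (2 * a)) = cheb x t * cheb x t.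
  by rewrite mulrCA mulr_natl cos_mulr2n -mulr_natl /cheb -/a; field.
apply: (eq_has_mean sqE); rewrite /cheb_weight; case: eqVneq => [x2|x2].
  rewrite [X in has_mean _ X](_ : _ = 2^-1 + 2^-1 * 1); last by field.
  apply: has_meanD; first exact: has_mean_cst.
  apply: has_meanZ; apply: (@eq_has_mean (fun=> 1)); last exact: has_mean_cst.
  move=> t; apply/esym; elim/ltn_ind: t => -[|[|t]] IH.
  - by rewrite mul0r cos0.
  - by rewrite mul1r cos2a x2; ring.
  - by rewrite cos_natSS !IH // cos2a x2; ring.
rewrite -[X in has_mean _ X]addr0; apply: has_meanD; first exact: has_mean_cst.
rewrite -[X in has_mean _ X](mulr0 2^-1); apply: has_meanZ.
(* The constant sequence 1 solves the same recurrence at the node 1, so the Wronskian argument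
   applies to this product. *)
apply: (@eq_has_mean (fun t => cos (t%:R * (2 * a)) * 1)).
  by move=> t; rewrite mulr1.
apply: (@has_mean_recurrence (2 * x ^+ 2 - 1) 1).
- apply: contraNneq x2 => E; apply/eqP; lra.
- by move=> t; exact: norm_cos_le1.
- by move=> t; rewrite normr1.
- by move=> t; rewrite cos_natSS cos2a.
- by move=> t; ring.
Qed.

(** Parseval's identity: the products of sequences at different nodes have mean 0. *)
Lemma has_mean_cheb_comb_sq (xs : seq R) (c : R -> R) :
  uniq xs -> (forall x, x \in xs -> -1 <= x <= 1) ->
  has_mean (fun t => (\sum_(x <- xs) c x * cheb x t) ^+ 2)
           (\sum_(x <- xs) cheb_weight x * c x ^+ 2).
Proof.
move=> xs_uniq xs1.
have -> : \sum_(x <- xs) cheb_weight x * c x ^+ 2 =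
    \sum_(x <- xs) \sum_(y <- xs) if x == y then cheb_weight x * c x ^+ 2 else 0.
  rewrite big_seq [RHS]big_seq; apply: eq_bigr => x xs_x.
  rewrite (bigD1_seq x) //= eqxx big1 ?addr0 // => y y_neq.
  by rewrite eq_sym (negbTE y_neq).
apply: (@eq_has_mean (fun t => \sum_(x <- xs) \sum_(y <- xs)
    (c x * c y) * (cheb x t * cheb y t))).
  move=> t; rewrite expr2 mulr_suml; apply: eq_bigr => x _.
  by rewrite mulr_sumr; apply: eq_bigr => y _; ring.
apply: has_mean_sum_seq => x xs_x; apply: has_mean_sum_seq => y xs_y.
case: eqVneq => [<-|xy].
  rewrite [X in has_mean _ X]mulrC expr2; apply: has_meanZ; apply: has_mean_cheb_sq; exact: xs1.
rewrite -(mulr0 (c x * c y)); apply: has_meanZ.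
by apply: has_mean_cheb_prod => //; exact: xs1.
Qed.

End CesaroMean.

(** * The average mixing matrix in terms of eigenvectors of the unmarked subgraph *)

Section QuantumWalk.
Variables (R : realType) (V : finType) (e : rel V) (k : nat) (S : {set V}).
Hypothesis e_sym : symmetric e.
Hypothesis e_reg : regular_graph e k.
Hypothesis k_gt0 : (0 < k)%N.

Local Notation U := (walk_mx R e k S).

Lemma sum_nbhd_cst (x : V) (c : R) : \sum_(z | e x z) c = k%:R * c.
Proof.
rewrite sumr_const mulr_natl -(e_reg x); congr (_ *+ _).
by apply: eq_card => z; rewrite !inE.
Qed.

Lemma sum_delta (I : finType) (x : I) (F : I -> R) : \sum_y (x == y)%:R * F y = F x.
Proof.
rewrite (bigD1 x) //= eqxx mul1r big1 ?addr0 // => y y_neq.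
by rewrite eq_sym (negbTE y_neq) mul0r.
Qed.

Lemma sum_enum_setT (F : V -> R) :
  \sum_(i < #|[set: V]|) F (enum_val i) = \sum_x F x.
Proof.
transitivity (\sum_(x in [set: V]) F x); first by rewrite [RHS]big_enum_val.
by apply: eq_bigl => x; rewrite inE.
Qed.

(** Arc vectors are handled as functions on all pairs of vertices; values off the arcs do not affect
    the vector. *)
Definition arc_col (g : V * V -> R) : 'cV[R]_#|arcs e| := \col_i g (enum_val i).

(** The action of [walk_mx] on functions: the coin acts at the head [p.2], as a Grover reflection if
    it is unmarked and as -1 if it is marked, and the arc is then reversed. *)
Definition walk_step (g : V * V -> R) (p : V * V) : R :=
  (if p.2 \in S then 0 else 2 / k%:R * \sum_(z | e p.2 z) g (p.2, z))
    - g (p.2, p.1).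

Lemma arc_colP (f g : V * V -> R) :
  (forall x y, e x y -> f (x, y) = g (x, y)) -> arc_col f = arc_col g.
Proof.
move=> fg; apply/colP => i; rewrite !mxE.
by move: (enum_valP i); case: (enum_val i) => x y; rewrite inE; exact: fg.
Qed.

Lemma walk_mx_arc_col g : U *m arc_col g = arc_col (walk_step g).
Proof.
have tailE : tail_incidence R e *m arc_col g =
    \col_i \sum_(z | e (enum_val i) z) g (enum_val i, z).
  apply/colP => i; rewrite !mxE.
  transitivity (\sum_(q in arcs e) (enum_val i == q.1)%:R * g q).
    by rewrite [RHS]big_enum_val; apply: eq_bigr => j _; rewrite !mxE.
  have -> : \sum_(q in arcs e) (enum_val i == q.1)%:R * g q =
      \sum_x \sum_(z | e x z) (enum_val i == x)%:R * g (x, z).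
    by rewrite pair_big_dep; apply: eq_big => [[x z]|[x z] _]; rewrite ?inE.
  rewrite -(sum_delta (enum_val i) (fun x => \sum_(z | e x z) g (x, z))).
  by apply: eq_bigr => x _; rewrite mulr_sumr.
have oracleE (f : V -> R) : oracle R S *m (\col_i f (enum_val i)) =
    \col_i (if enum_val i \in S then 0 else f (enum_val i)).
  apply/colP => i; rewrite !mxE.
  transitivity (\sum_x (enum_val i == x)%:R * (if x \in S then 0 else f x)).
    rewrite -[RHS]sum_enum_setT.
    apply: eq_bigr => j _; rewrite !mxE; case: eqVneq => [->|_].
      by case: (enum_val j \in S); rewrite /= ?mulr0 ?mul0r.
    by case: (_ && _); rewrite !mul0r.
  exact: sum_delta.
have trE (f : V -> R) : (tail_incidence R e)^T *m (\col_i f (enum_val i)) =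
    arc_col (fun p => f p.1).
  apply/colP => i; rewrite !mxE -(sum_delta (enum_val i).1 f).
  rewrite -[RHS]sum_enum_setT.
  by apply: eq_bigr => j _; rewrite !mxE eq_sym.
have revE (f : V * V -> R) : arc_reversal R e *m arc_col f =
    arc_col (fun p => f (p.2, p.1)).
  apply/colP => i; rewrite !mxE.
  have pA : ((enum_val i).2, (enum_val i).1) \in arcs e.
    by rewrite inE /= e_sym; have := enum_valP i; rewrite inE.
  transitivity (\sum_(q in arcs e) (q == ((enum_val i).2, (enum_val i).1))%:R * f q).
    by rewrite [RHS]big_enum_val; apply: eq_bigr => j _; rewrite !mxE.
  rewrite (bigD1 _ pA) /= eqxx mul1r big1 ?addr0 // => q /andP[_ /negbTE->].
  by rewrite mul0r.
rewrite /walk_mx -mulmxA mulmxBl mul1mx -scalemxAl -!mulmxA tailE.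
rewrite (oracleE (fun x => \sum_(z | e x z) g (x, z))).
rewrite (trE (fun x => if x \in S then 0 else \sum_(z | e x z) g (x, z))).
rewrite [X in _ *m X](_ : _ = arc_col (fun p =>
  2 / k%:R * (if p.1 \in S then 0 else \sum_(z | e p.1 z) g (p.1, z)) - g p)).
  rewrite revE; apply: arc_colP => x y _; rewrite /walk_step /=.
  by case: ifP; rewrite ?mulr0.
by apply/colP => i; rewrite !mxE.
Qed.

Lemma vertex_stateE v :
  vertex_state R e k v = arc_col (fun p => (Num.sqrt k%:R)^-1 * (p.1 == v)%:R).
Proof.
apply/colP => i; rewrite !mxE; congr (_ * _).
transitivity (\sum_x ((enum_val i).1 == x)%:R * (x == v)%:R : R); last exact: sum_delta.
rewrite -[RHS]sum_enum_setT.
by apply: eq_bigr => j _; rewrite !mxE eq_sym.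
Qed.

Lemma mixing_probE t u v (g : V * V -> R) :
  U ^+ t *m vertex_state R e k v = arc_col g ->
  mixing_prob R e k S t u v = \sum_(y | e u y) g (u, y) ^+ 2.
Proof.
move=> gE; rewrite /mixing_prob gE.
transitivity (\sum_(p in arcs e) if p.1 == u then g p ^+ 2 else 0).
  rewrite [RHS]big_enum_val [LHS]big_mkcond /=; apply: eq_bigr => j _.
  by rewrite mxE real_normK ?num_real.
transitivity (\sum_x \sum_(y | e x y) (u == x)%:R * g (x, y) ^+ 2); last first.
  rewrite -(sum_delta u (fun x => \sum_(y | e x y) g (x, y) ^+ 2)).
  by apply: eq_bigr => x _; rewrite mulr_sumr.
rewrite pair_big_dep; apply: eq_big => [[x z]|[x z] _]; rewrite ?inE //=.
by rewrite eq_sym; case: eqP; rewrite ?mul1r ?mul0r.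
Qed.

(** * The orbit of the state of a marked vertex [v], from the eigencomponents [y t] of the indicator
    of its unmarked neighbors *)

Variables (u v : V) (s : seq R) (y : R -> V -> R).
Hypothesis uS : u \in S.
Hypothesis vS : v \in S.
Hypothesis s_uniq : uniq s.
Hypothesis s_lt : forall t, t \in s -> `|t| < k%:R.
Hypothesis y_S : forall t x, x \in S -> y t x = 0.
Hypothesis y_eig : forall t x, t \in s -> x \notin S ->
  \sum_(z | e x z) y t z = t * y t x.
Hypothesis y_sum : forall x, x \notin S -> \sum_(t <- s) y t x = (e v x)%:R.

Let K : R := k%:R.
(** This normalization makes the sums of [w] over arcs with a given unmarked head vanish: there each
    component [y t] enters with coefficient [1 - kappa t * (K ^+ 2 - t ^+ 2) / K]. *)
Let kappa (t : R) : R := K / (K ^+ 2 - t ^+ 2).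

Let K_gt0 : 0 < K. Proof. by rewrite ltr0n. Qed.

Let K_neq0 : K != 0. Proof. by rewrite gt_eqF. Qed.

Let s_lt2 t : t \in s -> (K - t != 0) && (K + t != 0).
Proof.
move=> /s_lt; rewrite ltr_norml -/K => /andP[t_gt t_lt].
by apply/andP; split; rewrite gt_eqF //; lra.
Qed.

(* The component of the (rescaled) vertex state on which the walk acts as
   minus the arc reversal. *)
Let w (p : V * V) : R :=
  (p.1 == v)%:R - \sum_(t <- s) kappa t * (y t p.2 - t / K * y t p.1).

(* The walk rotates the plane spanned by [y t p.2] and [y t p.1]; the
   coefficients follow the Chebyshev recurrence at [t / K]. *)
Let phi (n : nat) (p : V * V) : R :=
  2^-1 * (w p - w (p.2, p.1)) + (-1) ^+ n * (2^-1 * (w p + w (p.2, p.1)))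
  + \sum_(t <- s) kappa t *
      (cheb (t / K) n * y t p.2
       + (cheb (t / K) n.+1 - 2 * (t / K) * cheb (t / K) n) * y t p.1).

Let ev_in t : t \in s -> -1 <= t / K <= 1.
Proof.
move=> /s_lt; rewrite ltr_norml -/K => /andP[t_gt t_lt].
by rewrite ler_pdivlMr // ler_pdivrMr // mulN1r mul1r !ltW.
Qed.

(** Together with [sum_w_head] this shows that the coin acts as -1 on [w] and on its reversal at
    unmarked vertices too. *)
Let sum_w_tail x : x \notin S -> \sum_(z | e x z) w (x, z) = 0.
Proof.
move=> xS; rewrite /w /= sumrB sum_nbhd_cst.
have -> : (x == v) = false by apply: contraNF xS => /eqP ->.
rewrite mulr0 exchange_big big_seq big1 ?subrr // => t ts.
rewrite -mulr_sumr sumrB y_eig // sum_nbhd_cst -/K.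
by rewrite mulrA mulrCA mulfV // mulr1 subrr mulr0.
Qed.

Let sum_w_head x : x \notin S -> \sum_(z | e x z) w (z, x) = 0.
Proof.
move=> xS; rewrite /w /= sumrB exchange_big /=.
have -> : \sum_(z | e x z) (z == v)%:R = \sum_(t <- s) y t x.
  rewrite y_sum // e_sym -(sum_delta v (fun z => (e x z)%:R)) big_mkcond.
  by apply: eq_bigr => z _; rewrite eq_sym; case: (e x z); rewrite ?mulr1 ?mulr0.
apply/eqP; rewrite subr_eq0; apply/eqP; rewrite big_seq [RHS]big_seq.
apply: eq_bigr => t ts; rewrite -mulr_sumr sumrB -mulr_sumr y_eig // sum_nbhd_cst -/K.
have /andP[H1 H2] := s_lt2 ts.
rewrite /kappa subr_sqr; field.
by rewrite K_neq0 H1 H2.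
Qed.

(** On [w] and its reversal the walk is minus the reversal, so it fixes the antisymmetric part and
    negates the symmetric one. At a marked head the components [y t] vanish; at an unmarked one
    their sums are given by the eigenvector equation, and the Chebyshev recurrence concludes. *)
Let walk_step_phi n x z : e x z -> walk_step (phi n) (x, z) = phi n.+1 (x, z).
Proof.
move=> exz; rewrite /walk_step /=; case: ifP => [zS|/negbT zS].
  rewrite /phi /= sub0r opprD exprS.
  congr (_ + _); first by ring.
  rewrite -sumrN big_seq [RHS]big_seq; apply: eq_bigr => t ts.
  by rewrite !(y_S t zS) chebSS ?ev_in //; ring.
have -> : \sum_(i | e z i) phi n (z, i) = \sum_(i | e z i) \sum_(t <- s) kappa t *
   (cheb (t / K) n * y t i +
    (cheb (t / K) n.+1 - 2 * (t / K) * cheb (t / K) n) * y t z).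
  have sumB : \sum_(i | e z i) 2^-1 * (w (z, i) - w (i, z)) = 0.
    by rewrite -mulr_sumr [X in _ * X]sumrB sum_w_tail // sum_w_head // subrr mulr0.
  have sumD : \sum_(i | e z i) (-1) ^+ n * (2^-1 * (w (z, i) + w (i, z))) = 0.
    rewrite -mulr_sumr -mulr_sumr [X in _ * (_ * X)]big_split /=.
    by rewrite sum_w_tail // sum_w_head // addr0 !mulr0.
  by rewrite /phi big_split big_split /= sumB sumD !add0r.
have -> : 2 / k%:R * (\sum_(i | e z i) \sum_(t <- s) kappa t *
   (cheb (t / K) n * y t i +
    (cheb (t / K) n.+1 - 2 * (t / K) * cheb (t / K) n) * y t z)) =
   \sum_(t <- s) kappa t * (2 * (cheb (t / K) n.+1 - t / K * cheb (t / K) n) * y t z).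
  rewrite exchange_big mulr_sumr big_seq [RHS]big_seq; apply: eq_bigr => t ts.
  rewrite -mulr_sumr big_split /= -mulr_sumr y_eig // sum_nbhd_cst -/K.
  by field.
rewrite /phi /= opprD addrCA -sumrN -big_split /= exprS.
congr (_ + _); first by ring.
rewrite big_seq [RHS]big_seq; apply: eq_bigr => t ts.
by rewrite chebSS ?ev_in //; ring.
Qed.

Lemma walk_state n : U ^+ n *m vertex_state R e k v =
  arc_col (fun p => (Num.sqrt K)^-1 * phi n p).
Proof.
elim: n => [|n IH].
  rewrite expr0 mul1mx vertex_stateE; apply: arc_colP => x z exz.
  congr (_ * _); rewrite /phi /= expr0 /w /=.
  (* At time 0 the Chebyshev values are 1 and [t / K], so this sum cancels the one subtracted in [w]
     and leaves the indicator of [v] at the tail. *)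
  rewrite [X in _ + X](_ : _ = \sum_(t <- s) kappa t * (y t z - t / K * y t x)).
    by field.
  rewrite big_seq [RHS]big_seq; apply: eq_bigr => t ts.
  by rewrite cheb0 cheb1 ?ev_in //; ring.
rewrite exprS -[_ * _]/(_ *m _) -mulmxA IH walk_mx_arc_col.
apply: arc_colP => x z exz; rewrite -walk_step_phi // /walk_step /= -mulr_sumr.
by case: ifP => _; ring.
Qed.

Lemma avg_vertex_mixingE :
  4 * K * avg_vertex_mixing R e k S u v =
  \sum_(z | e u z)
    (((u == v)%:R - (z == v)%:R - \sum_(t <- s) y t z / (K - t)) ^+ 2 +
     ((u == v)%:R + (z == v)%:R - \sum_(t <- s) y t z / (K + t)) ^+ 2 +
     2 * \sum_(t <- s) (K / (K ^+ 2 - t ^+ 2) * y t z) ^+ 2).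
Proof.
pose a z := (u == v)%:R - (z == v)%:R - \sum_(t <- s) y t z / (K - t).
pose b z := (u == v)%:R + (z == v)%:R - \sum_(t <- s) y t z / (K + t).
(* The nodes 1 and -1 carry the constant and the alternating sequence; [|t| < K] keeps the nodes
   [t / K] away from them. On arcs leaving [u], [y t u = 0] leaves only [cheb (t / K) n]. *)
pose xs := 1 :: -1 :: [seq t / K | t <- s].
pose c z x := if x == 1 then 2^-1 * a z else if x == -1 then 2^-1 * b z
              else kappa (x * K) * y (x * K) z.
have ev_neq t : t \in s -> (t / K != 1) && (t / K != -1).
  move=> /s_lt2/andP[H1 H2]; apply/andP; split.
    by apply: contraNneq H1 => E; rewrite -(divfK K_neq0 t) E mul1r subrr.
  by apply: contraNneq H2 => E; rewrite -(divfK K_neq0 t) E mulN1r subrr.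
have xs_uniq : uniq xs.
  rewrite /= !inE negb_or map_inj_uniq ?s_uniq ?andbT; last first.
    by move=> t1 t2 /(mulIf (invr_neq0 K_neq0)).
  apply/andP; split.
    apply/andP; split; first by rewrite gt_eqF //; lra.
    by apply/mapP => -[t /ev_neq/andP[/eqP H _]] /esym.
  by apply/mapP => -[t /ev_neq/andP[_ /eqP H]] /esym.
have xs_in x : x \in xs -> -1 <= x <= 1.
  rewrite !inE => /or3P[/eqP->|/eqP->|/mapP[t ts ->]]; last exact: ev_in.
    by apply/andP; split; lra.
  by apply/andP; split; lra.
have N1_neq1 : (-1 == 1 :> R) = false by rewrite lt_eqF //; lra.
have phiE n z : e u z -> \sum_(x <- xs) c z x * cheb x n = phi n (u, z).
  move=> euz; rewrite !big_cons /c eqxx N1_neq1 eqxx big_map /= cheb_at1 cheb_atN1 mulr1.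
  rewrite addrA /phi /=; congr (_ + _).
    rewrite /w /= /a /b.
    set W1 := \sum_(t <- s) kappa t * _; set W2 := \sum_(t <- s) kappa t * _.
    have -> : \sum_(t <- s) y t z / (K - t) = W1 - W2.
      rewrite -sumrB big_seq [RHS]big_seq; apply: eq_bigr => t ts.
      have /andP[H1 H2] := s_lt2 ts.
      rewrite !(y_S t uS) /kappa subr_sqr; field.
      by rewrite K_neq0 H1 H2.
    have -> : \sum_(t <- s) y t z / (K + t) = W1 + W2.
      rewrite -big_split big_seq [RHS]big_seq; apply: eq_bigr => t ts.
      have /andP[H1 H2] := s_lt2 ts.
      rewrite !(y_S t uS) /kappa subr_sqr /=; field.
      by rewrite K_neq0 H1 H2.
    by ring.
  rewrite big_seq [RHS]big_seq; apply: eq_bigr => t ts.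
  have /andP[/negbTE-> /negbTE->] := ev_neq _ ts.
  by rewrite divfK // (y_S t uS); ring.
have mean_phi z : e u z -> has_mean (fun n => (phi n (u, z)) ^+ 2)
    (4^-1 * (a z ^+ 2 + b z ^+ 2 + 2 * \sum_(t <- s) (kappa t * y t z) ^+ 2)).
  move=> euz; apply: (@eq_has_mean _
    (fun n => (\sum_(x <- xs) c z x * cheb x n) ^+ 2)).
    by move=> n; rewrite phiE.
  rewrite [X in has_mean _ X](_ : _ = \sum_(x <- xs) cheb_weight x * c z x ^+ 2).
    exact: has_mean_cheb_comb_sq.
  rewrite !big_cons big_map /c eqxx N1_neq1 eqxx /cheb_weight expr1n sqrrN expr1n eqxx.
  rewrite !mul1r addrA mulrDr mulrA; congr (_ + _); first by field.
  rewrite mulr_sumr big_seq [RHS]big_seq; apply: eq_bigr => t ts.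
  have /andP[H1 H2] := ev_neq _ ts.
  rewrite (negbTE H1) (negbTE H2) sqrf_eq1 (negbTE H1) (negbTE H2) /= divfK //.
  by field.
have mean_mix : has_mean (fun n => mixing_prob R e k S n u v) (\sum_(z | e u z) K^-1 *
    (4^-1 * (a z ^+ 2 + b z ^+ 2 + 2 * \sum_(t <- s) (kappa t * y t z) ^+ 2))).
  apply: (@eq_has_mean _ (fun n => \sum_(z | e u z) K^-1 * phi n (u, z) ^+ 2)).
    move=> n; rewrite (mixing_probE _ (walk_state n)); apply: eq_bigr => z _.
    by rewrite exprMn exprVn sqr_sqrtr ?ltW.
  rewrite -[X in has_mean _ X]big_filter.
  apply: (@eq_has_mean _ (fun n => \sum_(z <- [seq z <- index_enum V | e u z])
     K^-1 * phi n (u, z) ^+ 2)) => [n|]; first by rewrite big_filter.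
  apply: has_mean_sum_seq => z; rewrite mem_filter => /andP[euz _].
  by apply: has_meanZ; exact: mean_phi.
rewrite /avg_vertex_mixing.
have -> := cvg_lim (@Rhausdorff R) mean_mix.
rewrite mulr_sumr; apply: eq_bigr => z _; rewrite -/(a z) -/(b z) /kappa.
by field.
Qed.

End QuantumWalk.

(** * Functions on the unmarked subgraph *)

Section ConnectedGraph.
Variables (R : realType) (V : finType) (e : rel V).
Hypothesis e_conn : connected_graph e.

Lemma connected_ind (P : V -> Prop) x0 :
  P x0 -> (forall x z, e x z -> P x -> P z) -> forall x, P x.
Proof.
move=> Px0 P_step x; have /connectP[p + ->] := e_conn x0 x.
elim: p x0 Px0 => [|z p IH] x0 Px0 //= /andP[exz]; apply: IH.
exact: P_step Px0.
Qed.

Variables (k : nat) (S : {set V}) (s0 : V).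
Hypothesis e_reg : regular_graph e k.
Hypothesis s0_S : s0 \in S.

(** Minimum principle: a negative minimum would be attained off [S], spread to all neighbors, and by
    connectedness reach [s0], where [f] is 0. *)
Lemma superharmonic_ge0 (f : V -> R) :
  (forall x, x \in S -> f x = 0) ->
  (forall x, x \notin S -> \sum_(z | e x z) f z <= k%:R * f x) ->
  forall x, 0 <= f x.
Proof.
move=> f_S f_sup x; pose x0 := [arg min_(z < s0) f z]%O.
have f_min z : f x0 <= f z by rewrite /x0; case: arg_minP => // i _; apply.
apply: le_trans (f_min x); rewrite leNgt; apply/negP => f_lt0.
suff : f s0 = f x0 by rewrite f_S // => E; rewrite -E ltxx in f_lt0.
apply: (@connected_ind (fun z => f z = f x0) x0) => // z z' ezz' fz.
have zS : z \notin S by apply: contraTN f_lt0 => /f_S; rewrite fz => ->; rewrite ltxx.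
have : \sum_(z1 | e z z1) (f z1 - f x0) <= 0.
  by rewrite sumrB (sum_nbhd_cst e_reg) subr_le0 -fz f_sup.
rewrite le_eqVlt ltNge sumr_ge0 ?orbF => [/eqP sum0|i _]; last by rewrite subr_ge0.
apply/eqP; rewrite -subr_eq0; apply/eqP.
by apply: (psumr_eq0P _ sum0) => // i _; rewrite subr_ge0.
Qed.

End ConnectedGraph.

(** * Vectors on the unmarked vertices as functions on the whole graph, and walk counts *)

Section ExtensionByZero.
Variables (R : realType) (V : finType) (e : rel V) (S : {set V}).
Implicit Types c d : 'cV[R]_#|~: S|.

Definition ext c (x : V) : R := \sum_i (enum_val i == x)%:R * c i ord0.

Lemma ext_enum_val c i : ext c (enum_val i) = c i ord0.
Proof.
rewrite /ext (bigD1 i) //= eqxx mul1r big1 ?addr0 // => j j_neq.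
by rewrite (inj_eq enum_val_inj) (negbTE j_neq) mul0r.
Qed.

Lemma ext_in_S c x : x \in S -> ext c x = 0.
Proof.
move=> xS; apply: big1 => i _; case: eqP => [E|_]; last by rewrite mul0r.
by have := enum_valP i; rewrite E inE xS.
Qed.

Lemma sum_ext (F : V -> R) c :
  \sum_x F x * ext c x = \sum_i F (enum_val i) * c i ord0.
Proof.
under eq_bigr do rewrite mulr_sumr.
rewrite exchange_big; apply: eq_bigr => i _ /=.
by rewrite -(sum_delta (enum_val i) (fun x => F x * c i ord0)); apply: eq_bigr => x _; ring.
Qed.

Lemma extP c d : (forall x, x \notin S -> ext c x = ext d x) -> c = d.
Proof.
move=> cd; apply/colP => i; rewrite -!ext_enum_val; apply: cd.
by have := enum_valP i; rewrite inE.
Qed.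

Lemma ext_lin a b c d x : ext (a *: c + b *: d) x = a * ext c x + b * ext d x.
Proof.
by rewrite /ext !mulr_sumr -big_split /=; apply: eq_bigr => i _; rewrite !mxE; ring.
Qed.

Lemma ext_scale a c x : ext (a *: c) x = a * ext c x.
Proof. by rewrite /ext mulr_sumr; apply: eq_bigr => i _; rewrite !mxE; ring. Qed.

Lemma ext_sum (I : Type) (r : seq I) (F : I -> 'cV[R]_#|~: S|) x :
  ext (\sum_(i <- r) F i) x = \sum_(i <- r) ext (F i) x.
Proof.
by rewrite /ext exchange_big; apply: eq_bigr => i _; rewrite summxE mulr_sumr.
Qed.

Lemma notin_enum_val x : x \notin S -> exists i : 'I_#|~: S|, x = enum_val i.
Proof.
move=> xS; have xC : x \in ~: S by rewrite inE.
by exists (enum_rank_in xC x); rewrite enum_rankK_in.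
Qed.

Definition nbhd_col (v : V) : 'cV[R]_#|~: S| := \col_i (e v (enum_val i))%:R.

Lemma ext_nbhd_col v x : x \notin S -> ext (nbhd_col v) x = (e v x)%:R.
Proof. by move=> /notin_enum_val[i ->]; rewrite ext_enum_val mxE. Qed.

Lemma nbhd_colE v : v \in S ->
  (adj_block R e S (~: S))^T *m std_vec R S v = nbhd_col v.
Proof.
move=> vS; apply/colP => i; rewrite !mxE.
transitivity (\sum_(x in S) (x == v)%:R * (e x (enum_val i))%:R : R).
  rewrite [RHS]big_enum_val; apply: eq_bigr => j _.
  by rewrite !mxE mulrC.
rewrite (bigD1 v) //= eqxx mul1r big1 ?addr0 // => x /andP[_ /negbTE->].
by rewrite mul0r.
Qed.

Local Notation A := (adj_block R e (~: S) (~: S)).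

Lemma ext_adj c x : x \notin S -> ext (A *m c) x = \sum_(z | e x z) ext c z.
Proof.
move=> /notin_enum_val[i ->]; rewrite ext_enum_val mxE.
transitivity (\sum_z (e (enum_val i) z)%:R * ext c z).
  by rewrite sum_ext; apply: eq_bigr => j _; rewrite mxE.
rewrite [RHS]big_mkcond; apply: eq_bigr => z _.
by case: (e _ _); rewrite ?mul1r ?mul0r.
Qed.

Lemma adj_block_sym : symmetric e -> A^T = A.
Proof. by move=> e_sym; apply/matrixP => i j; rewrite !mxE e_sym. Qed.

(** Induction on the first step of a walk. It turns walk-equitability into constancy of the powers
    of [A] applied to [nbhd_col v], on the unmarked neighbors of each marked vertex. *)
Lemma nb_walks_avoidingE m v x : x \notin S ->
  (nb_walks_avoiding e S m x (nbhd e v :\: S))%:R =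
  ext (iter m (mulmx A) (nbhd_col v)) x.
Proof.
elim: m x => [|m IH] x xS.
  rewrite ext_nbhd_col // /nb_walks_avoiding; congr (_%:R).
  transitivity #|[set p : 0.-tuple V | e v x]|.
    congr #|pred_of_set _|; apply/setP => p; rewrite !inE (tuple0 p) /= xS.
    by rewrite andbT.
  by rewrite cardsE; case: (e v x); rewrite ?card0 // card_tuple expn0.
rewrite /= ext_adj // (bigID (mem S)) /= big1 ?add0r => [|z /andP[_]]; last exact: ext_in_S.
pose W z (p : seq V) :=
  [&& path e z p, all (fun y => y \notin S) (z :: p) & last z p \in nbhd e v :\: S].
transitivity (\sum_(z | e x z && (z \notin S))
    (nb_walks_avoiding e S m z (nbhd e v :\: S))%:R : R); last first.
  by apply: eq_bigr => z /andP[_ /IH].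
rewrite -natr_sum; congr (_%:R).
transitivity (\sum_(z | e x z && (z \notin S)) \sum_(p : m.-tuple V | W z p) 1)%N; last first.
  by apply: eq_bigr => z _; rewrite sum1dep_card.
rewrite pair_big_dep sum1dep_card /nb_walks_avoiding /=.
(* A walk of length [m.+1] is recorded as its first step and the remaining walk. *)
pose cons_pair (zp : V * m.-tuple V) : m.+1.-tuple V := [tuple of zp.1 :: zp.2].
have cons_inj : injective cons_pair.
  move=> [z p] [z' p'] /(congr1 val) /= [-> pp']; congr (_, _); exact: val_inj.
rewrite -(card_imset _ cons_inj).
apply: eq_card => p; rewrite !inE; apply/idP/imsetP.
  case/tupleP: p => z p /= /and3P[/andP[exz zp] /and3P[_ zS pS] lp].
  exists (z, p); last exact: val_inj.
  by rewrite inE /W /= exz zS zp pS !inE lp.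
move=> [[z q]]; rewrite inE /W /= => /andP[/andP[exz zS]] /and3P[zq /andP[_ qS] lq] ->.
by rewrite /= exz zq xS zS qS; rewrite !inE in lq.
Qed.

End ExtensionByZero.

(** * Odd cycles and almost bipartite graphs *)

Section Cycles.
Variables (V : finType) (e : rel V).
Hypothesis e_sym : symmetric e.
Hypothesis e_irr : irreflexive e.

(** The labels are translated modulo the length of the cycle. *)
Lemma odd_cycle_based (u : V) : odd_cycle_graph e ->
  exists (n : nat) (f : 'I_n.+1 -> V),
    [/\ odd n.+1, (2 < n.+1)%N, bijective f, f ord0 = u &
        forall i j : 'I_n.+1, e (f i) (f j) =
          (i.+1 == j %[mod n.+1])%N || (j.+1 == i %[mod n.+1])%N].
Proof.
move=> [[|n] [f [n_odd n_gt2 f_bij f_e]]] //; have [g fK gK] := f_bij.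
pose h (i : 'I_n.+1) := f (inord ((i + g u) %% n.+1)).
have modE i : (inord ((i + g u) %% n.+1) : 'I_n.+1) = ((i + g u) %% n.+1)%N :> nat.
  by rewrite inordK // ltn_mod.
exists n, h; split=> //.
- apply: inj_card_bij.
    move=> i j /(bij_inj f_bij)/(congr1 val)/=; rewrite !modE => /eqP.
    rewrite eqn_modDr !modn_small // => /eqP; exact: val_inj.
  by rewrite -(bij_eq_card f_bij).
- rewrite /h add0n modn_small //; have -> : inord (g u) = g u by exact: inord_val.
  exact: gK.
move=> i j; rewrite /h f_e !modE !modn_mod.
by rewrite -addn1 -[in X in _ || X]addn1 !modnDml !(addnAC _ _ 1) !addn1 !eqn_modDr.
Qed.

Lemma next_nth_mod (x0 : V) (c : seq V) i : uniq c -> (i < size c)%N ->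
  next c (nth x0 c i) = nth x0 c (i.+1 %% size c).
Proof.
move=> c_uniq i_lt; rewrite next_nth mem_nth //.
case: c c_uniq i_lt => [//|z c] c_uniq i_lt.
rewrite index_uniq //; move: i_lt; rewrite /= ltnS leq_eqVlt => /orP[/eqP->|i_lt].
  by rewrite modnn nth_default.
rewrite modn_small //=; exact: set_nth_default.
Qed.

Hypothesis e_conn : connected_graph e.

(** In a longest simple path every neighbor of the first vertex [x] lies on the path. Its neighbor
    other than the second vertex must be the last one, which closes the path into a cycle. Degree 2
    and connectedness leave no vertex outside. *)
Lemma two_regular_cycle : regular_graph e 2 -> odd #|V| -> odd_cycle_graph e.
Proof.
move=> e_reg V_odd.
have [v0 _] : exists v : V, v \in V by apply/card_gt0P; case: #|V| V_odd.
pose P m := [exists t : m.+1.-tuple V, uniq t && sorted e t].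
have P0 : P 0%N by apply/existsP; exists [tuple v0].
have P_le m : P m -> (m <= #|V|)%N.
  case/existsP => t /andP[/card_uniqP t_card _].
  by rewrite ltnW // -(size_tuple t) -t_card max_card.
have [m /existsP[t /andP[t_uniq t_sorted]] m_max] := ex_maxnP (ex_intro P 0%N P0) P_le.
case/tupleP: t t_uniq t_sorted => x p /= /andP[x_p p_uniq] xp.
have nbr3 z z1 z2 z3 : e z z1 -> e z z2 -> e z z3 -> uniq [:: z1; z2; z3] -> false.
  move=> h1 h2 h3 /card_uniqP h; suff : (3 <= #|nbhd e z|)%N by rewrite e_reg.
  rewrite -[3%N]h; apply: subset_leq_card; apply/fintype.subsetP => w.
  by rewrite !inE => /or3P[] /eqP ->.
have Nx z : e x z -> z \in (p : seq V).
  move=> exz; apply: contraT => z_p.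
  suff /m_max : P m.+1 by rewrite ltnn.
  apply/existsP; exists [tuple of z :: x :: p].
  rewrite /= inE negb_or z_p x_p p_uniq e_sym exz xp !andbT.
  by apply: contraTneq exz => ->; rewrite e_irr.
pose c := x :: (p : seq V).
have c_uniq : uniq c by rewrite /= x_p.
have [y [exy y_last]] : exists y, e x y /\ y != nth x c 1.
  have : (1 < #|nbhd e x|)%N by rewrite e_reg.
  case/card_gt1P => y [y' []]; rewrite !inE => h h' yy'.
  case: (eqVneq y (nth x c 1)) => [E|]; last by exists y.
  by exists y'; split=> //; rewrite -E eq_sym.
have c_path i : (i.+1 < size c)%N -> e (nth x c i) (nth x c i.+1).
  by move=> i_lt; have /pathP := xp => /(_ x i); apply.
have y_p := Nx _ exy.
have y_c : y \in c by rewrite inE y_p orbT.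
have x_c : x \in c by rewrite inE eqxx.
have cE : c = x :: p by [].
have c0 : nth x c 0 = x by [].
clearbody c.
pose j := index y c.
have j_lt : (j < size c)%N by rewrite index_mem.
have cj : nth x c j = y by exact: nth_index.
have j_gt1 : (1 < j)%N.
  case: j cj {j_lt} => [|[|//]] cj; last by rewrite -cj eqxx in y_last.
  by move: exy; rewrite -cj c0 e_irr.
(* Otherwise [y] would have three neighbors: [x] and the two vertices next to it on the path. *)
have j_last : j.+1 = size c.
  apply/eqP; rewrite eqn_leq j_lt leqNgt; apply/negP => j1_lt.
  have := nbr3 y (nth x c j.-1) (nth x c j.+1) (nth x c 0).
  rewrite -{1 2}cj.
  have -> : e (nth x c j) (nth x c j.-1).
    by rewrite e_sym -{2}(prednK (ltnW j_gt1)) c_path // prednK // ltnW.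
  rewrite c_path // c0 e_sym exy => /(_ isT isT isT) j_uniq.
  suff /j_uniq : uniq [:: nth x c j.-1; nth x c j.+1; x] by [].
  have j0_lt : (j.-1 < size c)%N := leq_ltn_trans (leq_pred _) j_lt.
  have size0 : (0 < size c)%N := leq_ltn_trans (leq0n _) j_lt.
  rewrite -{3}c0 /= !inE !nth_uniq // !negb_or andbT.
  by case: (j) j_gt1 => [|[|j']] //= _; rewrite neq_ltn leqnSn.
have c_cycle : cycle e c.
  rewrite cE /= rcons_path xp /=.
  have -> : last x p = y by rewrite -cj (last_nth x) -cE; congr nth; move: j_last; rewrite cE => -[].
  by rewrite e_sym.
have size_c : (2 < size c)%N by rewrite -j_last.
have size_c0 : (0 < size c)%N := ltnW (ltnW size_c).
have nextE z : z \in c -> next c z = nth x c ((index z c).+1 %% size c).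
  by move=> zc; rewrite -{1}(nth_index x zc) next_nth_mod // index_mem.
(* If the two coincided, advancing twice would fix [z], so the length would divide 2. *)
have next_prev_neq z : z \in c -> next c z != prev c z.
  move=> zc; apply: contraTneq size_c => E.
  have zc' : (index z c < size c)%N by rewrite index_mem.
  have : next c (next c z) = z by rewrite E (next_prev c_uniq).
  rewrite (nextE z) // next_nth_mod ?ltn_mod // -{2}(nth_index x zc).
  move/eqP; rewrite nth_uniq ?ltn_mod // -[in X in X == _]addn1 modnDml addn1.
  rewrite -{2}(modn_small zc') -addn2 -{2}(addn0 (index z c)) eqn_modDl mod0n.
  by rewrite -/(dvdn _ _) -leqNgt => /dvdn_leq ->.
have NE z : z \in c -> nbhd e z = [set next c z; prev c z].
  move=> zc; apply/esym/eqP; rewrite eqEcard e_reg cards2 next_prev_neq // andbT.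
  apply/fintype.subsetP => w; rewrite !inE => /orP[] /eqP ->.
    exact: next_cycle.
  by rewrite e_sym; exact: prev_cycle.
have c_all z : z \in c.
  have /connectP[q + ->] := e_conn x z.
  elim: q (x) x_c => //= w q IH x' x'c /andP[ex'w]; apply: IH.
  have : w \in nbhd e x' by rewrite inE.
  by rewrite NE // !inE => /orP[] /eqP ->; rewrite ?mem_next ?mem_prev.
have size_cV : size c = #|V|.
  by rewrite -(card_uniqP c_uniq); apply: eq_card => z; rewrite c_all.
exists (size c), (fun i => nth x c i); split=> //; first by rewrite size_cV.
  apply: inj_card_bij; last by rewrite card_ord size_cV.
  by move=> i i' /eqP; rewrite nth_uniq // => /eqP; exact: val_inj.
move=> i i'; have -> : e (nth x c i) (nth x c i') = (nth x c i' \in nbhd e (nth x c i)).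
  by rewrite inE.
have nthE (i1 i2 : 'I_(size c)) :
    (nth x c i2 == next c (nth x c i1)) = (i1.+1 == i2 %[mod size c])%N.
  by rewrite next_nth_mod // nth_uniq ?ltn_mod // eq_sym (modn_small (ltn_ord i2)).
rewrite NE // !inE nthE; congr (_ || _); rewrite -nthE.
by apply/eqP/eqP => [->|->]; rewrite ?(next_prev c_uniq) ?(prev_next c_uniq).
Qed.

End Cycles.

(** * Two-colorings that are proper except possibly inside the marked pair *)

Section AlmostBipartite.
Variables (V : finType) (e : rel V) (k : nat) (S B : {set V}) (u v : V).
Hypothesis e_sym : symmetric e.
Hypothesis e_irr : irreflexive e.
Hypothesis e_conn : connected_graph e.
Hypothesis e_reg : regular_graph e k.
Hypothesis SE : S = [set u; v].
Hypothesis B_alt : forall x z, e x z -> ~~ ((x \in S) && (z \in S)) ->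
  (x \in B) != (z \in B).

Lemma almost_bipartite_bipartite :
  (e u v -> (u \in B) != (v \in B)) -> bipartite_graph e.
Proof.
move=> uv; exists B => x z exz; have [|] := boolP ((x \in S) && (z \in S)); last exact: B_alt.
rewrite SE !inE => /andP[/orP[] /eqP xE /orP[] /eqP zE]; move: exz; rewrite xE zE ?e_irr //.
by rewrite e_sym eq_sym.
Qed.

(** Double counting of the edges between [B] and its complement: every vertex sends all its [k]
    edges across, except that [u] and [v] each lose the edge joining them. *)
Lemma almost_bipartite_count : u != v -> e u v -> u \notin B -> v \notin B ->
  (k * #|~: B| = k * #|B| + 2)%N.
Proof.
move=> uv euv uB vB.
have S_B x : x \in S -> x \notin B by rewrite SE !inE => /orP[] /eqP ->.
have inB x : x \in B -> k = #|nbhd e x :&: ~: B|.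
  move=> xB; rewrite -(e_reg x); apply: eq_card => z; rewrite !inE.
  case exz : (e x z) => //=; have := B_alt exz; rewrite xB.
  by case: (x \in S) (S_B x) => [/(_ isT)|_ /(_ isT)]; rewrite ?xB //; case: (z \in B).
have notinB x : x \notin B -> k = (#|nbhd e x :&: B| + (x \in S))%N.
  move=> xB; rewrite -(e_reg x) -(cardsID B (nbhd e x)); congr (_ + _)%N.
  have [xS|xS] := boolP (x \in S).
    have [x' x'E xx'] : exists2 x', e x x' & S = [set x; x'].
      move: xS; rewrite SE !inE => /orP[] /eqP ->; first by exists v.
      by exists u; [rewrite e_sym | rewrite finset.setUC].
    apply/eqP/cards1P; exists x'; apply/finset.setP => z; rewrite !inE.
    apply/andP/eqP => [[zB exz]|->]; last first.
      by split=> //; apply: S_B; rewrite xx' !inE eqxx orbT.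
    have : (x \in S) && (z \in S).
      by apply: contraT => /(B_alt exz); rewrite (negbTE xB) (negbTE zB).
    rewrite xS xx' !inE => /orP[] /eqP // zx; by rewrite zx e_irr in exz.
  apply/eqP; rewrite cards_eq0; apply/eqP/setP => z; rewrite !inE.
  apply/negP => /andP[zB exz]; have := B_alt exz.
  by rewrite (negbTE xS) (negbTE xB) (negbTE zB) => /(_ isT).
have countB : (\sum_(x in B) #|nbhd e x :&: ~: B| = \sum_(x in ~: B) #|nbhd e x :&: B|)%N.
  transitivity (\sum_(x in B) \sum_(z in ~: B) e x z)%N.
    apply: eq_bigr => x _; rewrite -sum1_card big_mkcond [RHS]big_mkcond.
    by apply: eq_bigr => z _; rewrite !inE; case: (e x z); case: (z \in B).
  rewrite exchange_big; apply: eq_bigr => x _ /=; rewrite -sum1_card big_mkcond [RHS]big_mkcond.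
  by apply: eq_bigr => z _; rewrite !inE e_sym; case: (e x z); case: (z \in B).
rewrite ![(k * _)%N]mulnC -!sum_nat_const.
rewrite (eq_bigr (fun x => #|nbhd e x :&: B| + (x \in S))%N); last first.
  by move=> x; rewrite inE => /notinB.
rewrite big_split /= -countB; congr (_ + _)%N; first by apply: eq_bigr => x /inB.
transitivity #|S|; last by rewrite SE cards2 uv.
rewrite -sum1_card big_mkcond [RHS]big_mkcond; apply: eq_bigr => x _; rewrite inE.
by case: (boolP (x \in S)) => [/S_B -> //|_]; case: ifP.
Qed.

End AlmostBipartite.

(** The coloring is proper unless [u] and [v] are adjacent of equal color. In that case the edge
    count shows that [k] divides 2, hence [k = 2], and that the color classes differ by one vertex,
    so the order is odd. *)
Lemma almost_bipartite_cases (V : finType) (e : rel V) (k : nat) (S B : {set V})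
    (u v : V) :
  symmetric e -> irreflexive e -> connected_graph e -> regular_graph e k ->
  S = [set u; v] -> u != v -> (e u v -> k != 1%N) ->
  (forall x z, e x z -> ~~ ((x \in S) && (z \in S)) -> (x \in B) != (z \in B)) ->
  odd_cycle_graph e \/ bipartite_graph e.
Proof.
move=> e_sym e_irr e_conn e_reg SE uv euv_k1.
wlog uB : B / u \notin B => [IH B_alt|B_alt].
  have [uB|uB] := boolP (u \in B); last exact: IH B_alt.
  apply: (IH (~: B)); first by rewrite inE uB.
  by move=> x z exz xz; rewrite !inE (inj_eq negb_inj); exact: B_alt.
have [euv|neuv] := boolP (e u v); last first.
  right; apply: (almost_bipartite_bipartite e_sym e_irr SE B_alt).
  by rewrite (negbTE neuv).
have [vB|vB] := boolP (v \in B).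
  right; apply: (almost_bipartite_bipartite e_sym e_irr SE B_alt).
  by rewrite (negbTE uB) vB.
left; have count := almost_bipartite_count e_sym e_irr e_reg SE B_alt uv euv uB vB.
have k2 : k = 2%N.
  have : (k %| 2)%N by rewrite -(dvdn_addr 2 (dvdn_mulr #|B| (dvdnn k))) -count dvdn_mulr.
  by case: (k) (euv_k1 euv) => [|[|[|m]]] // _ /dvdn_leq; rewrite ?dvd0n // => /(_ isT).
apply: two_regular_cycle => //; first by rewrite -k2.
move: count; rewrite k2 !mul2n -[2%N]/(1.*2) -doubleD => /double_inj E.
by rewrite -(cardsC B) E addnA addn1 oddS addnn odd_double.
Qed.

(** * Green functions of the unmarked subgraph *)

Section MarkedGraph.
Variables (R : realType) (V : finType) (e : rel V) (k : nat) (S : {set V}).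
Hypothesis e_sym : symmetric e.
Hypothesis e_reg : regular_graph e k.
Hypothesis e_conn : connected_graph e.
Hypothesis k_gt0 : (0 < k)%N.
Variable s0 : V.
Hypothesis s0_S : s0 \in S.
Hypothesis S_equit : walk_equitable_nbhds e S.

Local Notation A := (adj_block R e (~: S) (~: S)).

Variables (s : seq R) (G : R -> 'M[R]_#|~: S|).
Hypothesis AG : eigen_decomposition A s G.
Hypothesis G_closed : forall (t : R) (K : 'cV[R]_#|~: S| -> Prop),
  (forall a b x y, K x -> K y -> K (a *: x + b *: y)) ->
  (forall x, K x -> K (A *m x)) -> forall x, K x -> K (G t *m x).

Let K : R := k%:R.
Let K_gt0 : 0 < K. Proof. by rewrite ltr0n. Qed.

Definition eigen_part (v : V) (t : R) (x : V) : R := ext (G t *m nbhd_col R e S v) x.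

(* [(k - A)^-1] and [(k + A)^-1] applied to the characteristic vector of
   [N(v) \ S]. *)
Definition green (v x : V) : R := \sum_(t <- s) eigen_part v t x / (K - t).
Definition signless_green (v x : V) : R :=
  \sum_(t <- s) eigen_part v t x / (K + t).

Local Notation y := eigen_part.
Local Notation a := green.
Local Notation b := signless_green.

Lemma eigen_part_in_S v t x : x \in S -> y v t x = 0.
Proof. exact: ext_in_S. Qed.

Lemma green_in_S v x : x \in S -> a v x = 0.
Proof. by move=> xS; apply: big1 => t _; rewrite eigen_part_in_S // mul0r. Qed.

Lemma signless_green_in_S v x : x \in S -> b v x = 0.
Proof. by move=> xS; apply: big1 => t _; rewrite eigen_part_in_S // mul0r. Qed.

(** If [|t| >= k], minus the absolute value of any column of [G t] is superharmonic off [S] and 0 on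
    [S], hence nonnegative. Then [G t] would vanish. *)
Lemma eigenvalue_lt t : t \in s -> `|t| < K.
Proof.
case: AG => _ G_neq0 G_eig _ ts; rewrite ltNge; apply: contra (G_neq0 _ ts) => t_ge.
have [_ _ AGt] := G_eig _ ts.
apply/eqP/matrixP => i j; rewrite mxE.
pose c := col j (G t).
have Ac : A *m c = t *: c by rewrite /c colE mulmxA AGt -scalemxAl.
have c_le : forall x, 0 <= - `|ext c x|.
  apply: (superharmonic_ge0 e_conn e_reg s0_S) => x xS.
    by rewrite ext_in_S // normr0 oppr0.
  rewrite sumrN mulrN lerN2 (le_trans (ler_wpM2r (normr_ge0 _) t_ge)) //.
  by rewrite -normrM -ext_scale -Ac ext_adj // ler_norm_sum.
have := c_le (enum_val i); rewrite oppr_ge0 normr_le0 ext_enum_val mxE.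
by move/eqP.
Qed.

Lemma eigenvalue_neq t : t \in s -> (K - t != 0) && (K + t != 0).
Proof.
move=> /eigenvalue_lt; rewrite ltr_norml => /andP[t_gt t_lt].
by apply/andP; split; rewrite gt_eqF //; lra.
Qed.

Lemma eigen_part_eig v t x : t \in s -> x \notin S ->
  \sum_(z | e x z) y v t z = t * y v t x.
Proof.
case: AG => _ _ G_eig _ ts xS; have [_ _ AGt] := G_eig _ ts.
by rewrite -ext_adj // mulmxA AGt -scalemxAl ext_scale.
Qed.

Lemma eigen_part_sum v x : x \notin S -> \sum_(t <- s) y v t x = (e v x)%:R.
Proof.
case: AG => _ _ _ sumG xS.
by rewrite -ext_sum -mulmx_suml sumG mul1mx ext_nbhd_col.
Qed.

(** As [G t] is a symmetric idempotent, one copy of it can be moved to the other side of the inner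
    product. *)
Lemma eigen_part_dot u v t : t \in s ->
  \sum_(x | e u x) y v t x = \sum_x y u t x * y v t x.
Proof.
case: AG => _ _ G_eig _ ts; have [G_sym G_idem _] := G_eig _ ts.
transitivity (\sum_x (e u x)%:R * y v t x).
  rewrite big_mkcond; apply: eq_bigr => x _.
  by case: (e u x); rewrite ?mul1r ?mul0r.
rewrite !sum_ext.
transitivity (((nbhd_col R e S u)^T *m (G t *m nbhd_col R e S v)) ord0 ord0).
  by rewrite mxE; apply: eq_bigr => i _; rewrite !mxE.
rewrite -{1}G_idem -mulmxA mulmxA -{1}G_sym -trmx_mul mxE.
by apply: eq_bigr => i _; rewrite /eigen_part ext_enum_val mxE.
Qed.

Lemma green_eq v x : x \notin S -> K * a v x = \sum_(z | e x z) a v z + (e v x)%:R.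
Proof.
move=> xS; rewrite exchange_big -(eigen_part_sum v xS) -big_split mulr_sumr /=.
rewrite big_seq [RHS]big_seq; apply: eq_bigr => t ts.
rewrite -mulr_suml eigen_part_eig //; have /andP[H1 _] := eigenvalue_neq ts.
by field.
Qed.

Lemma signless_green_eq v x : x \notin S ->
  K * b v x = (e v x)%:R - \sum_(z | e x z) b v z.
Proof.
move=> xS; rewrite exchange_big -(eigen_part_sum v xS) -sumrB mulr_sumr /=.
rewrite big_seq [RHS]big_seq; apply: eq_bigr => t ts.
rewrite -mulr_suml eigen_part_eig //; have /andP[_ H1] := eigenvalue_neq ts.
by field.
Qed.

Lemma green_ge0 v x : 0 <= a v x.
Proof.
apply: (superharmonic_ge0 e_conn e_reg s0_S) => {}x xS; first exact: green_in_S.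
by rewrite -/K green_eq // lerDl.
Qed.

(** By the equations of [a] and [b] and the triangle inequality, [a - |b|] is superharmonic off [S]
    and vanishes on [S]. *)
Lemma norm_signless_green v x : `|b v x| <= a v x.
Proof.
rewrite -subr_ge0; apply: (superharmonic_ge0 (f := fun x => a v x - `|b v x|)
  e_conn e_reg s0_S) => {}x xS.
  by rewrite green_in_S // signless_green_in_S // normr0 subrr.
rewrite sumrB mulrBr -/K green_eq // -addrA lerD2l.
rewrite -[X in _ - X * _]ger0_norm ?(ltW K_gt0) // -normrM signless_green_eq //.
rewrite lerNl opprB lerBlDr (le_trans (ler_normB _ _)) // addrC.
rewrite [`|_%:R|]ger0_norm // lerD2r.
exact: ler_norm_sum.
Qed.

(** Minus the absolute value of the difference of two solutions is superharmonic off [S] and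
    vanishes on [S]. *)
Lemma signless_green_unique v (f : V -> R) :
  (forall x, x \in S -> f x = 0) ->
  (forall x, x \notin S -> K * f x = (e v x)%:R - \sum_(z | e x z) f z) ->
  forall x, b v x = f x.
Proof.
move=> f_S f_eq x; apply/eqP; rewrite -subr_eq0 -normr_le0 -oppr_ge0.
apply: (superharmonic_ge0 (f := fun x => - `|b v x - f x|) e_conn e_reg s0_S) => {}x xS.
  by rewrite f_S // signless_green_in_S // subrr normr0 oppr0.
rewrite sumrN mulrN lerN2 -/K -[X in X * _]ger0_norm ?(ltW K_gt0) // -normrM mulrBr.
rewrite signless_green_eq // f_eq //.
have -> : (e v x)%:R - \sum_(z | e x z) b v z - ((e v x)%:R - \sum_(z | e x z) f z) =
    \sum_(z | e x z) (f z - b v z) by rewrite sumrB; ring.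
rewrite (le_trans (ler_norm_sum _ _ _)) //; apply: ler_sum => z _.
by rewrite distrC.
Qed.

(** The indicator of the unmarked vertices minus the sum is harmonic off [S] and 0 on [S]; the
    minimum principle applies to it and to its opposite. *)
Lemma sum_green x : x \notin S -> \sum_(v in S) a v x = 1.
Proof.
pose f x := (if x \in S then 0 else 1) - \sum_(v in S) a v x.
have f_S z : z \in S -> f z = 0.
  by move=> zS; rewrite /f zS big1 ?subrr // => v _; exact: green_in_S.
have f_eq z : z \notin S -> K * f z = \sum_(w | e z w) f w.
  move=> zS; rewrite /f (negbTE zS) mulrBr mulr1 sumrB [X in _ = _ - X]exchange_big mulr_sumr /=.
  have -> : \sum_(i in S) K * a i z =
      \sum_(i in S) \sum_(w | e z w) a i w + \sum_(i in S) (e i z)%:R.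
    by rewrite -big_split; apply: eq_bigr => i _; exact: green_eq.
  rewrite opprD addrCA [RHS]addrC; congr (_ + _).
  have -> : K = \sum_(w | e z w) 1 by rewrite (sum_nbhd_cst e_reg) mulr1.
  have -> : \sum_(i in S) (e i z)%:R = \sum_(w | e z w) (w \in S)%:R :> R.
    rewrite big_mkcond [RHS]big_mkcond; apply: eq_bigr => w _.
    by rewrite e_sym; case: ifP; case: ifP.
  by rewrite -sumrB; apply: eq_bigr => w _; case: ifP; rewrite ?subrr ?subr0.
move=> xS; have f0 : f x = 0.
  apply/eqP; rewrite eq_le; apply/andP; split.
    rewrite -oppr_ge0; apply: (superharmonic_ge0 (f := fun x => - f x) e_conn e_reg s0_S).
      by move=> z /f_S ->; rewrite oppr0.
    by move=> z /f_eq E; rewrite sumrN mulrN E.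
  apply: (superharmonic_ge0 e_conn e_reg s0_S) => // z /f_eq E.
  by rewrite -/K E.
by move: f0; rewrite /f (negbTE xS) => /eqP; rewrite subr_eq0 => /eqP.
Qed.

(** Agreement at [x] and [x'] of all powers of [A] applied to a vector is a linear condition stable
    under [A], so it passes to [G t]. For [nbhd_col v] it is walk-equitability. *)
Lemma eigen_part_cst u v t x x' : u \in S -> v \in S ->
  x \in nbhd e u :\: S -> x' \in nbhd e u :\: S -> y v t x = y v t x'.
Proof.
move=> uS vS xN xN'.
pose P (c : 'cV[R]_#|~: S|) := forall m, ext (iter m (mulmx A) c) x = ext (iter m (mulmx A) c) x'.
suff : P (G t *m nbhd_col R e S v) by move=> /(_ 0%N).
apply: (@G_closed t P) => [p q c d Pc Pd m|c Pc m|m].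
- have iter_lin : iter m (mulmx A) (p *: c + q *: d) =
      p *: iter m (mulmx A) c + q *: iter m (mulmx A) d.
    by elim: m => //= m ->; rewrite mulmxDr -!scalemxAr.
  by rewrite iter_lin !ext_lin Pc Pd.
- by rewrite -iterSr; exact: Pc.
have xS : x \notin S by move: xN; rewrite inE => /andP[].
have xS' : x' \notin S by move: xN'; rewrite inE => /andP[].
by rewrite -!nb_walks_avoidingE // (S_equit m uS vS xN xN').
Qed.

Lemma green_cst u v x x' : u \in S -> v \in S ->
  x \in nbhd e u :\: S -> x' \in nbhd e u :\: S -> a v x = a v x'.
Proof.
by move=> uS vS xN xN'; apply: eq_bigr => t _; rewrite (eigen_part_cst t uS vS xN xN').
Qed.

Lemma signless_green_cst u v x x' : u \in S -> v \in S ->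
  x \in nbhd e u :\: S -> x' \in nbhd e u :\: S -> b v x = b v x'.
Proof.
by move=> uS vS xN xN'; apply: eq_bigr => t _; rewrite (eigen_part_cst t uS vS xN xN').
Qed.

(** * Sums over neighborhoods, and the entries of the mixing matrix in terms of them *)

Definition out_deg (u : V) : R := #|nbhd e u :\: S|%:R.
Definition nbhd_green (u v : V) : R := \sum_(x | e u x) a v x.
Definition nbhd_signless_green (u v : V) : R := \sum_(x | e u x) b v x.
(** For [t] in [s] this is the entry at [(u, v)] of [H G_t H^T], and [eigen_part_dot] identifies it
    with the sum of [y v t] over the neighbors of [u]. *)
Definition nbhd_gram (t : R) (u v : V) : R := \sum_x y u t x * y v t x.

Local Notation d := out_deg.
Local Notation al := nbhd_green.
Local Notation be := nbhd_signless_green.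
Local Notation q := nbhd_gram.

Lemma nbhd_gramC t u v : q t u v = q t v u.
Proof. by apply: eq_bigr => x _; rewrite mulrC. Qed.

Lemma nbhd_greenE u v : al u v = \sum_(t <- s) q t u v / (K - t).
Proof.
rewrite /al exchange_big big_seq [RHS]big_seq; apply: eq_bigr => t ts.
by rewrite -mulr_suml eigen_part_dot.
Qed.

Lemma nbhd_signless_greenE u v : be u v = \sum_(t <- s) q t u v / (K + t).
Proof.
rewrite /be exchange_big big_seq [RHS]big_seq; apply: eq_bigr => t ts.
by rewrite -mulr_suml eigen_part_dot.
Qed.

Lemma nbhd_greenC u v : al u v = al v u.
Proof. by rewrite !nbhd_greenE; apply: eq_bigr => t _; rewrite nbhd_gramC. Qed.

Lemma nbhd_signless_greenC u v : be u v = be v u.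
Proof. by rewrite !nbhd_signless_greenE; apply: eq_bigr => t _; rewrite nbhd_gramC. Qed.

Lemma sum_out_nbhd u (F : V -> R) : (forall x, x \in S -> F x = 0) ->
  \sum_(x | e u x) F x = \sum_(x in nbhd e u :\: S) F x.
Proof.
move=> F_S; rewrite (bigID (mem S)) /= big1 ?add0r => [|x /andP[_]]; last exact: F_S.
by apply: eq_bigl => x; rewrite !inE andbC.
Qed.

Lemma sum_out_nbhd_cst u (F : V -> R) c :
  (forall x, x \in nbhd e u :\: S -> F x = c) ->
  \sum_(x in nbhd e u :\: S) F x = d u * c.
Proof. by move=> Fc; rewrite (eq_bigr _ Fc) sumr_const mulr_natl. Qed.

Lemma sum_gram u : \sum_(t <- s) q t u u = d u.
Proof.
transitivity (\sum_(x | e u x) \sum_(t <- s) y u t x).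
  rewrite [RHS]exchange_big big_seq [RHS]big_seq; apply: eq_bigr => t ts.
  by rewrite /= eigen_part_dot.
rewrite sum_out_nbhd => [|x xS]; last by apply: big1 => t _; exact: eigen_part_in_S.
rewrite (sum_out_nbhd_cst (c := 1)) ?mulr1 // => x; rewrite !inE => /andP[xS eux].
by rewrite eigen_part_sum // eux.
Qed.

Lemma nbhd_gram_ge0 t u : 0 <= q t u u.
Proof. by apply: sumr_ge0 => x _; rewrite -expr2 sqr_ge0. Qed.

Lemma nbhd_gram_sub t u v (c : R) : c ^+ 2 = 1 ->
  \sum_x (y u t x - c * y v t x) ^+ 2 = q t u u + q t v v - 2 * c * q t u v.
Proof.
move=> c1; rewrite /q mulr_sumr -big_split -sumrB; apply: eq_bigr => x _ /=.
by rewrite sqrrB exprMn c1; ring.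
Qed.

Lemma nbhd_gram_CS t u v : 2 * `|q t u v| <= q t u u + q t v v.
Proof.
have H c : c ^+ 2 = 1 -> 0 <= q t u u + q t v v - 2 * c * q t u v.
  by move=> c1; rewrite -nbhd_gram_sub //; apply: sumr_ge0 => x _; exact: sqr_ge0.
have := H 1 (expr1n _ _); have := H (-1); rewrite sqrrN expr1n => /(_ erefl).
by case: (ger0P (q t u v)) => _; lra.
Qed.

Let sum_in_S u v : u \in S -> v \in S ->
  \sum_(z | e u z && (z \in S)) (2 * (u == v)%:R + 2 * (z == v)%:R) =
  2 * (u == v)%:R * (K - d u) + 2 * (e u v)%:R :> R.
Proof.
move=> uS vS; rewrite big_split /= sumr_const -!mulr_sumr; congr (_ + _ * _).
  rewrite -[LHS]mulr_natr; congr (_ * _); rewrite /K /d -(e_reg u).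
  rewrite -(cardsID S (nbhd e u)) natrD addrK; congr (_%:R).
  by apply: eq_card => z; rewrite !inE.
rewrite -(sum_delta v (fun z => (e u z)%:R)) big_mkcond; apply: eq_bigr => z _.
rewrite eq_sym; case: eqP => [<-|_]; last by rewrite mul0r; case: ifP.
by rewrite vS andbT; case: (e u v); rewrite ?mulr1 ?mulr0.
Qed.

(** All neighbors of [u] are marked, so every Green term is 0. This covers the case where the scaled
    formula below reads [0 = 0]. *)
Lemma avg_vertex_mixing_isolated u v : u \in S -> v \in S -> d u = 0 ->
  4 * K * avg_vertex_mixing R e k S u v = 2 * (u == v)%:R * K + 2 * (e u v)%:R.
Proof.
move=> uS vS d0; case: (AG) => s_uniq _ _ _.
rewrite (@avg_vertex_mixingE _ _ _ _ _ e_sym e_reg k_gt0 u v s (y v) uS vS s_uniq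
  eigenvalue_lt (@eigen_part_in_S v) (@eigen_part_eig v) (@eigen_part_sum v)).
have := sum_in_S uS vS; rewrite d0 subr0 => <-.
have N_S z : e u z -> z \in S.
  move=> euz; apply: contraT => zS; move/eqP: d0; rewrite pnatr_eq0 cards_eq0 => /eqP/finset.setP/(_ z).
  by rewrite !inE zS euz.
apply: eq_big => [z|z /N_S zS]; first by case euz : (e u z); rewrite ?(N_S _ euz).
rewrite -/(a v z) -/(b v z) green_in_S // signless_green_in_S // big1 => [|t _]; last first.
  by rewrite eigen_part_in_S // mulr0 expr0n.
by case: (u == v); case: (z == v); rewrite /=; ring.
Qed.

(** By equitability the summands are constant on the [d u] unmarked neighbors, so after
    multiplication by [d u] sums of squares become squares of sums. The last term comes from the
    marked neighbors. *)
Lemma scaled_avg_vertex_mixing u v : u \in S -> v \in S ->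
  4 * K * d u * avg_vertex_mixing R e k S u v =
  ((u == v)%:R * d u - al u v) ^+ 2 + ((u == v)%:R * d u - be u v) ^+ 2
  + 2 * \sum_(t <- s) (K / (K ^+ 2 - t ^+ 2)) ^+ 2 * q t u v ^+ 2
  + d u * (2 * (u == v)%:R * (K - d u) + 2 * (e u v)%:R).
Proof.
move=> uS vS; case: (AG) => s_uniq _ _ _.
rewrite mulrAC (@avg_vertex_mixingE _ _ _ _ _ e_sym e_reg k_gt0 u v s (y v) uS vS s_uniq
  eigenvalue_lt (@eigen_part_in_S v) (@eigen_part_eig v) (@eigen_part_sum v)).
rewrite (bigID (mem S)) /= mulrDl addrC; congr (_ + _); last first.
  rewrite mulrC; congr (_ * _); rewrite -sum_in_S //; apply: eq_bigr => z /andP[_ zS].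
  rewrite -/(a v z) -/(b v z) green_in_S // signless_green_in_S // big1 => [|t _]; last first.
    by rewrite eigen_part_in_S // mulr0 expr0n.
  by case: (u == v); case: (z == v); rewrite /=; ring.
rewrite (eq_bigl (fun z => z \in nbhd e u :\: S)); last by move=> z; rewrite !inE andbC.
have [N0|[x xN]] := set_0Vmem (nbhd e u :\: S).
  have d0 : d u = 0 by rewrite /d N0 cards0.
  have al0 : al u v = 0.
    by rewrite /al sum_out_nbhd ?N0 ?big_set0 // => z; exact: green_in_S.
  have be0 : be u v = 0.
    by rewrite /be sum_out_nbhd ?N0 ?big_set0 // => z; exact: signless_green_in_S.
  have q0 t : t \in s -> q t u v = 0.
    move=> ts; rewrite /q -eigen_part_dot // sum_out_nbhd ?N0 ?big_set0 // => z.
    exact: eigen_part_in_S.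
  rewrite d0 al0 be0 !mulr0 subrr expr0n /= big_seq big1 => [|t /q0 ->]; first by ring.
  by rewrite expr0n mulr0.
have alE : al u v = d u * a v x.
  rewrite /al sum_out_nbhd => [|z]; last exact: green_in_S.
  by apply: sum_out_nbhd_cst => z zN; exact: green_cst zN xN.
have beE : be u v = d u * b v x.
  rewrite /be sum_out_nbhd => [|z]; last exact: signless_green_in_S.
  by apply: sum_out_nbhd_cst => z zN; exact: signless_green_cst zN xN.
have qE t : t \in s -> q t u v = d u * y v t x.
  move=> ts; rewrite /q -eigen_part_dot // sum_out_nbhd => [|z]; last exact: eigen_part_in_S.
  by apply: sum_out_nbhd_cst => z zN; exact: eigen_part_cst zN xN.
rewrite (sum_out_nbhd_cst (c := ((u == v)%:R - a v x) ^+ 2 + ((u == v)%:R - b v x) ^+ 2 +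
  2 * \sum_(t <- s) (K / (K ^+ 2 - t ^+ 2) * y v t x) ^+ 2)) => [|z zN].
  rewrite alE beE.
  have -> : \sum_(t <- s) (K / (K ^+ 2 - t ^+ 2)) ^+ 2 * q t u v ^+ 2 =
      d u ^+ 2 * \sum_(t <- s) (K / (K ^+ 2 - t ^+ 2) * y v t x) ^+ 2.
    rewrite mulr_sumr big_seq [RHS]big_seq; apply: eq_bigr => t ts.
    by rewrite qE // !exprMn mulrCA.
  by ring.
have zv : (z == v) = false.
  by apply/eqP => E; move: zN; rewrite E inE vS.
rewrite zv subr0 addr0 -/(a v z) -/(b v z) (green_cst uS vS zN xN).
rewrite (signless_green_cst uS vS zN xN); congr (_ + _ * _).
by apply: eq_bigr => t _; rewrite (eigen_part_cst t uS vS zN xN).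
Qed.

Lemma out_degE u : K = d u + \sum_(v in S) (e u v)%:R.
Proof.
rewrite /K /d -(e_reg u) -(cardsID S (nbhd e u)) natrD addrC; congr (_ + _).
rewrite -sum1_card natr_sum big_mkcond [RHS]big_mkcond; apply: eq_bigr => v _.
by rewrite !inE andbC; case: (v \in S); case: (e u v).
Qed.

Lemma sum_nbhd_green u : \sum_(v in S) al u v = d u.
Proof.
rewrite /al exchange_big sum_out_nbhd => [|x xS]; last first.
  by apply: big1 => v _; exact: green_in_S.
rewrite (sum_out_nbhd_cst (c := 1)) ?mulr1 // => x; rewrite inE => /andP[xS _].
exact: sum_green.
Qed.

Lemma nbhd_green_ge0 u v : 0 <= al u v.
Proof. by apply: sumr_ge0 => x _; exact: green_ge0. Qed.

Lemma norm_nbhd_signless_green u v : `|be u v| <= al u v.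
Proof.
apply: le_trans (ler_norm_sum _ _ _) _; apply: ler_sum => x _.
exact: norm_signless_green.
Qed.

Lemma green_le1 u x : u \in S -> a u x <= 1.
Proof.
move=> uS; have [xS|xS] := boolP (x \in S); first by rewrite green_in_S.
rewrite -(sum_green xS) (bigD1 u) //= lerDl; apply: sumr_ge0 => v _; exact: green_ge0.
Qed.

(* [green u z] is the probability that a random walk from [z] enters [S] at [u];
   if it is 1 then every path from [z] to [S] enters [S] at [u]. *)
Lemma green_full u : u \in S ->
  (forall z, e u z -> z \notin S /\ a u z = 1) -> forall x, x \in S -> x = u.
Proof.
move=> uS uN x xS.
suff : x = u \/ x \notin S /\ a u x = 1 by case=> // -[]; rewrite xS.
apply: (connected_ind e_conn (P := fun x => x = u \/ x \notin S /\ a u x = 1) (x0 := u)).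
  by left.
move=> {xS}x z exz [E|[xS ax]]; first by right; apply: uN; rewrite -E.
have ge0 w : 0 <= 1 - a u w - (w == u)%:R.
  case: eqP => [->|_]; first by rewrite green_in_S // subr0 subrr.
  by rewrite subr0 subr_ge0 green_le1.
(* This is the Green equation at [x], where [a u x = 1]; the nonnegative terms must then all
   vanish. *)
have sum0 : \sum_(w | e x w) (1 - a u w - (w == u)%:R) = 0.
  rewrite !sumrB (sum_nbhd_cst e_reg) -/K mulr1.
  have -> : \sum_(w | e x w) (w == u)%:R = (e u x)%:R :> R.
    rewrite e_sym -(sum_delta u (fun w => (e x w)%:R)) big_mkcond.
    by apply: eq_bigr => w _; rewrite eq_sym; case: (e x w); rewrite ?mulr1 ?mulr0.
  by have := green_eq u xS; rewrite ax; lra.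
have := psumr_eq0P (fun w _ => ge0 w) sum0 exz.
case: eqP => [|_] H; [by left | right].
have az : a u z = 1 by move: H; rewrite subr0; lra.
split=> //; apply/negP => zS; move: az; rewrite green_in_S // => /esym/eqP.
by rewrite oner_eq0.
Qed.

(** Signs given by a proper coloring of the unmarked part turn the equation of [a w] into that of
    [b w], whose solution is unique. *)
Lemma signless_green_coloring (w : V) (B : {set V}) : w \in S ->
  (forall x z, e x z -> x \notin S -> z \notin S -> (x \in B) != (z \in B)) ->
  (forall x, e w x -> x \notin S -> (x \in B) != (w \in B)) ->
  forall x, b w x = (if (x \in B) == (w \in B) then -1 else 1) * a w x.
Proof.
move=> wS B_alt w_alt; apply: signless_green_unique => x xS.
  by rewrite green_in_S // mulr0.
rewrite mulrCA green_eq //.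
have -> : \sum_(z | e x z) (if (z \in B) == (w \in B) then -1 else 1) * a w z =
    - (if (x \in B) == (w \in B) then -1 else 1) * \sum_(z | e x z) a w z.
  rewrite mulr_sumr; apply: eq_bigr => z exz.
  have [zS|zS] := boolP (z \in S); first by rewrite green_in_S // !mulr0.
  have := B_alt _ _ exz xS zS.
  by case: (x \in B); case: (z \in B); case: (w \in B) => //= _; ring.
case ewx : (e w x); last by rewrite /=; ring.
by have := w_alt _ ewx xS; case: (x \in B); case: (w \in B) => //= _; ring.
Qed.

(** * The case of exactly two marked vertices *)

Section TwoMarked.
Variables (u v : V).
Hypothesis uv : u != v.
Hypothesis SE : S = [set u; v].

Let uS : u \in S. Proof. by rewrite SE !inE eqxx. Qed.
Let vS : v \in S. Proof. by rewrite SE !inE eqxx orbT. Qed.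

Lemma sum_two (F : V -> R) : \sum_(w in S) F w = F u + F v.
Proof. by rewrite SE big_setU1 ?big_set1 // inE. Qed.

Lemma green_two x : x \notin S -> a u x + a v x = 1.
Proof. by move=> /sum_green; rewrite sum_two. Qed.

Lemma nbhd_green_two w : al w u + al w v = d w.
Proof. by rewrite -sum_nbhd_green sum_two. Qed.

(** If [a v] vanished at one unmarked neighbor of [u], by equitability it would vanish at all of
    them, so [a u] would be 1 there and [green_full] would give [v = u]. *)
Lemma green_nonzero x : ~~ e u v -> irreflexive e -> x \in nbhd e u :\: S -> a v x != 0.
Proof.
move=> neuv e_irr xN; apply/eqP => ax.
have : v = u.
  apply: (green_full uS) => // z euz.
  have zS : z \notin S.
    by apply/negP; rewrite SE !inE => /orP[] /eqP E; move: euz; rewrite E ?e_irr ?(negbTE neuv).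
  split=> //; have := green_two zS.
  by rewrite (green_cst uS vS (x := z) _ xN) ?ax ?addr0 // !inE zS.
by move=> E; move: uv; rewrite E eqxx.
Qed.

(* The function [D] below, equal to [-1] at [u] and [-sg] at [v], is
   anti-harmonic outside [S] and bounded by 1; as it takes the values 1 next to
   [u] and [sg] next to [v], it is a sign everywhere. *)
Lemma green_almost_bipartite (sg : R) : sg ^+ 2 = 1 ->
  be u u = al u u -> be v v = al v v -> sg * be u v = al u v ->
  exists B : {set V}, forall x z, e x z -> ~~ ((x \in S) && (z \in S)) ->
    (x \in B) != (z \in B).
Proof.
move=> sg2 beu bev beuv.
have sg_abs : `|sg| = 1.
  by apply/eqP; rewrite -(@eqrXn2 _ 2) // -normrX sg2 normr1 expr1n.
pose D x := b u x + sg * b v x - (x == u)%:R - sg * (x == v)%:R.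
have Du : D u = -1.
  by rewrite /D !signless_green_in_S // eqxx (negbTE uv) /=; ring.
have Dv : D v = - sg.
  by rewrite /D !signless_green_in_S // eqxx eq_sym (negbTE uv) /=; ring.
have DY x : x \notin S -> D x = b u x + sg * b v x.
  rewrite SE !inE negb_or => /andP[/negbTE xu /negbTE xv].
  by rewrite /D xu xv mulr0 !subr0.
have D_le1 x : `|D x| <= 1.
  have [|xS] := boolP (x \in S).
    rewrite SE !inE => /orP[] /eqP ->; first by rewrite Du normrN normr1.
    by rewrite Dv normrN sg_abs.
  rewrite DY // -(green_two xS) (le_trans (ler_normD _ _)) // normrM sg_abs mul1r.
  by rewrite lerD ?norm_signless_green.
have D_eq x : x \notin S -> K * D x = - \sum_(z | e x z) D z.
  move=> xS; rewrite DY // mulrDr mulrCA !signless_green_eq // /D !sumrB big_split /=.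
  rewrite -!mulr_sumr.
  have delta w : \sum_(z | e x z) (z == w)%:R = (e w x)%:R :> R.
    rewrite e_sym -(sum_delta w (fun z => (e x z)%:R)) big_mkcond.
    by apply: eq_bigr => z _; rewrite eq_sym; case: (e x z); rewrite ?mulr1 ?mulr0.
  by rewrite !delta; ring.
(* Since [|D| <= 1], an anti-harmonic average of absolute value 1 forces every neighbor to take the
   opposite sign. *)
have D_step x z : x \notin S -> e x z -> D x ^+ 2 = 1 -> D z = - D x.
  move=> xS exz Dx2.
  have ge0 w : 0 <= 1 + D x * D w.
    have := D_le1 w; have := D_le1 x; rewrite !ler_norml => /andP[h1 h2] /andP[h3 h4].
    by nra.
  have sum0 : \sum_(w | e x w) (1 + D x * D w) = 0.
    rewrite big_split /= -mulr_sumr (sum_nbhd_cst e_reg) -/K mulr1.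
    have := D_eq _ xS => /(congr1 (fun r => - (D x * r))).
    rewrite mulrN opprK => <-; rewrite mulrCA -expr2 Dx2; ring.
  have := psumr_eq0P (fun w _ => ge0 w) sum0 exz => H.
  have E : D z = D x ^+ 2 * D z by rewrite Dx2 mul1r.
  by rewrite E expr2 -mulrA (_ : D x * D z = -1) ?mulrN1 //; lra.
have eq_term w (f g : V -> R) : (forall x, f x <= g x) ->
    \sum_(x | e w x) f x = \sum_(x | e w x) g x -> forall x, e w x -> f x = g x.
  move=> fg /esym/eqP; rewrite -subr_eq0 -sumrB => /eqP sum0 x ewx.
  have := psumr_eq0P _ sum0 ewx => H.
  by apply/eqP; rewrite eq_sym -subr_eq0 H // => x' _; rewrite subr_ge0.
have b_le w x : b w x <= a w x by rewrite (le_trans (ler_norm _)) // norm_signless_green.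
have sgb_le w x : sg * b w x <= a w x.
  rewrite (le_trans (ler_norm _)) // normrM sg_abs mul1r; exact: norm_signless_green.
(* The termwise bounds by [a] hold with equality because the sums over the neighborhood agree. *)
have D_nu z : z \notin S -> e u z -> D z = 1.
  move=> zS euz; rewrite DY // (eq_term u (b u) (a u) (b_le u) beu z euz).
  rewrite (eq_term u (fun z => sg * b v z) (a v) (sgb_le v) _ z euz) ?green_two //.
  by rewrite -mulr_sumr.
have D_nv z : z \notin S -> e v z -> D z = sg.
  move=> zS evz; rewrite DY // (eq_term v (b v) (a v) (b_le v) bev z evz).
  have := eq_term v (fun z => sg * b u z) (a u) (sgb_le u) _ z evz.
  rewrite -mulr_sumr -/(be v u) nbhd_signless_greenC beuv nbhd_greenC => /(_ erefl) E.
  have -> : b u z = sg * a u z by rewrite -E mulrA -expr2 sg2 mul1r.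
  by rewrite -mulrDr green_two // mulr1.
have D_nS x z : x \in S -> z \notin S -> e x z -> D z = - D x.
  move=> + zS; rewrite SE !inE => /orP[] /eqP -> exz.
    by rewrite D_nu // Du opprK.
  by rewrite D_nv // Dv opprK.
have DS x : x \in S -> D x ^+ 2 = 1.
  by rewrite SE !inE => /orP[] /eqP ->; rewrite ?Du ?Dv sqrrN ?expr1n.
have D2 x : D x ^+ 2 = 1.
  apply: (connected_ind e_conn (P := fun x => D x ^+ 2 = 1) (x0 := u)); first exact: DS.
  move=> {}x z exz Dx; have [zS|zS] := boolP (z \in S); first exact: DS.
  have [xS|xS] := boolP (x \in S); first by rewrite (D_nS x) // sqrrN.
  by rewrite (D_step x) // sqrrN.
have D_edge x z : e x z -> ~~ ((x \in S) && (z \in S)) -> D z = - D x.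
  move=> exz; have [xS|xS] := boolP (x \in S) => /= zS; first exact: D_nS.
  exact: D_step.
exists [set x | D x == 1] => x z exz xz; rewrite !inE (D_edge _ _ exz xz).
have N1 : (-1 == 1 :> R) = false by rewrite lt_eqF //; lra.
by have /eqP := D2 x; rewrite sqrf_eq1 => /orP[] /eqP ->; rewrite ?opprK eqxx N1.
Qed.

End TwoMarked.

(** * Cauchy-Schwarz for the eigenprojections and its equality case *)

Local Notation M := (avg_vertex_mixing R e k S).

Lemma psumr_seq_eq0 (F : R -> R) :
  (forall t, t \in s -> 0 <= F t) -> \sum_(t <- s) F t = 0 ->
  forall t, t \in s -> F t = 0.
Proof.
move=> F_ge0 /eqP; rewrite big_seq psumr_eq0 // => /allP F0 t ts.
by have := F0 t ts; rewrite ts => /eqP.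
Qed.

Definition gram_energy (u v : V) : R :=
  \sum_(t <- s) (K / (K ^+ 2 - t ^+ 2)) ^+ 2 * q t u v ^+ 2.

Local Notation Q := gram_energy.

Lemma gram_weight_gt0 t : t \in s -> 0 < (K / (K ^+ 2 - t ^+ 2)) ^+ 2.
Proof.
move=> /eigenvalue_neq/andP[H1 H2]; rewrite exprn_even_gt0 //=.
by apply: mulf_neq0; [rewrite gt_eqF | rewrite invr_eq0 subr_sqr mulf_neq0].
Qed.

Lemma gram_energyC u v : Q u v = Q v u.
Proof. by apply: eq_bigr => t _; rewrite nbhd_gramC. Qed.

Lemma gram_energy_ge0 u v : 0 <= Q u v.
Proof. by apply: sumr_ge0 => t _; rewrite mulr_ge0 ?sqr_ge0. Qed.

Lemma gram_energy_eq0 u : Q u u = 0 -> d u = 0.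
Proof.
move=> Q0; rewrite -sum_gram big_seq big1 // => t ts.
apply/eqP; rewrite -sqrf_eq0.
have /eqP := psumr_seq_eq0 (fun t _ => mulr_ge0 (sqr_ge0 _) (sqr_ge0 _)) Q0 ts.
by rewrite mulf_eq0 gt_eqF ?gram_weight_gt0.
Qed.

(** With [p], [r] the diagonal values and [z] the absolute off-diagonal one, twice the expression is
    [(p - r)^2 + (p + r - 2 z)(p + r + 2 z)]. *)
Lemma gram_term_ge0 t u v : 0 <= q t u u ^+ 2 + q t v v ^+ 2 - 2 * q t u v ^+ 2.
Proof.
have := nbhd_gram_CS t u v; rewrite -(real_normK (num_real (q t u v))).
have := nbhd_gram_ge0 t u; have := nbhd_gram_ge0 t v; have := normr_ge0 (q t u v).
set z := `|_|; set p := q t u u; set r := q t v v => z0 r0 p0 zpr.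
have := sqr_ge0 (p - r); have : 0 <= (p + r - 2 * z) * (p + r + 2 * z).
  by apply: mulr_ge0; lra.
by nra.
Qed.

Lemma gram_energy_CS u v : Q u u + Q v v - 2 * Q u v =
  \sum_(t <- s) (K / (K ^+ 2 - t ^+ 2)) ^+ 2 *
     (q t u u ^+ 2 + q t v v ^+ 2 - 2 * q t u v ^+ 2).
Proof. by rewrite mulr_sumr -big_split -sumrB; apply: eq_bigr => t _ /=; ring. Qed.

Lemma gram_term_eq0 t u v :
  q t u u ^+ 2 + q t v v ^+ 2 - 2 * q t u v ^+ 2 = 0 ->
  q t v v = q t u u /\ q t u v ^+ 2 = q t u u ^+ 2.
Proof.
have := nbhd_gram_CS t u v; rewrite -(real_normK (num_real (q t u v))).
have := nbhd_gram_ge0 t u; have := nbhd_gram_ge0 t v; have := normr_ge0 (q t u v).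
set z := `|_|; set p := q t u u; set r := q t v v => z0 r0 p0 zpr E.
have H : 0 <= (p + r - 2 * z) * (p + r + 2 * z) by apply: mulr_ge0; lra.
have pr : (p - r) ^+ 2 = 0 by apply/eqP; rewrite eq_le sqr_ge0 andbT; nra.
have {}pr : r = p by move/eqP: pr; rewrite sqrf_eq0 subr_eq0 => /eqP.
by split=> //; move: E; rewrite pr; lra.
Qed.

(** The hypotheses make the squared norm of the difference or of the sum of the two vectors
    vanish. *)
Lemma gram_sign t u v : q t v v = q t u u -> q t u v ^+ 2 = q t u u ^+ 2 ->
  G t *m nbhd_col R e S u = G t *m nbhd_col R e S v \/
  G t *m nbhd_col R e S u = - (G t *m nbhd_col R e S v).
Proof.
move=> qv /eqP; have sub0 (c : R) : c ^+ 2 = 1 ->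
    q t u u + q t v v - 2 * c * q t u v = 0 -> forall x, y u t x = c * y v t x.
  move=> c1; rewrite -nbhd_gram_sub // => sum0 x.
  have /eqP := psumr_eq0P (fun x _ => sqr_ge0 (y u t x - c * y v t x)) sum0 (erefl : xpredT x).
  by rewrite sqrf_eq0 subr_eq0 => /eqP.
rewrite eqf_sqr => /orP[] /eqP quv; [left | right]; apply: extP => x _.
  rewrite -[LHS]/(y u t x) (sub0 1) ?expr1n ?mul1r //.
  by rewrite qv quv; ring.
rewrite -scaleN1r ext_scale -[LHS]/(y u t x) (sub0 (-1)) ?sqrrN ?expr1n //.
by rewrite qv quv; ring.
Qed.

Lemma sign_gram t u v :
  G t *m nbhd_col R e S u = G t *m nbhd_col R e S v \/
  G t *m nbhd_col R e S u = - (G t *m nbhd_col R e S v) ->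
  q t v v = q t u u /\ q t u v ^+ 2 = q t u u ^+ 2.
Proof.
have H (c : R) : c ^+ 2 = 1 -> (forall x, y u t x = c * y v t x) ->
    q t v v = q t u u /\ q t u v ^+ 2 = q t u u ^+ 2.
  move=> c1 E.
  have quu : q t u u = q t v v.
    by apply: eq_bigr => x _; rewrite E mulrACA -expr2 c1 mul1r.
  have quv : q t u v = c * q t v v.
    by rewrite /q mulr_sumr; apply: eq_bigr => x _; rewrite E mulrA.
  by rewrite quv quu exprMn c1 mul1r.
case=> E; [apply: (H 1) | apply: (H (-1))]; rewrite ?sqrrN ?expr1n // => x.
  by rewrite mul1r /y E.
by rewrite /y E -scaleN1r ext_scale.
Qed.

Lemma out_deg_edge_le u v : v \in S -> d u + (e u v)%:R <= K.
Proof. by move=> vS; rewrite (out_degE u) (bigD1 v) //= lerD2l lerDl sumr_ge0. Qed.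

Lemma out_deg_ge0 u : 0 <= d u.
Proof. exact: ler0n. Qed.

Hypothesis e_irr : irreflexive e.

Lemma scaled_avg_vertex_mixing_diag u : u \in S ->
  4 * K * d u * M u u = (d u - al u u) ^+ 2 + (d u - be u u) ^+ 2 + 2 * Q u u
  + 2 * d u * (K - d u).
Proof.
by move=> uS; rewrite scaled_avg_vertex_mixing // eqxx e_irr /= -/(Q u u); ring.
Qed.

Lemma scaled_avg_vertex_mixing_off u v : u \in S -> v \in S -> u != v ->
  4 * K * d u * M u v = al u v ^+ 2 + be u v ^+ 2 + 2 * Q u v
  + 2 * d u * (e u v)%:R.
Proof.
move=> uS vS /negbTE uv; rewrite scaled_avg_vertex_mixing // uv /= -/(Q u v).
by ring.
Qed.

Lemma nbhd_green_le u v : u \in S -> v \in S -> u != v -> al u v <= d u - al u u.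
Proof.
move=> uS vS uv; rewrite lerBrDl -sum_nbhd_green (bigD1 u) //= lerD2l.
rewrite (bigD1 v) ?vS 1?eq_sym //= lerDl; apply: sumr_ge0 => w _; exact: nbhd_green_ge0.
Qed.

(** * Consequences of a uniform marked block *)

Section Uniform.
Variable c : R.
Hypothesis M_cst : forall u v, u \in S -> v \in S -> M u v = c.

(** Subtracting the identities for [(u, v)] and [(v, u)] gives [(d v - d u) (2 K c - e u v) = 0]. If
    the second factor vanishes, the diagonal identity forces [Q u u = 0], hence [d u = 0]. *)
Lemma uniform_out_deg u v : u \in S -> v \in S -> u != v -> d u != 0 -> d v = d u.
Proof.
move=> uS vS uv du; have vu : v != u by rewrite eq_sym.
have Euv := scaled_avg_vertex_mixing_off uS vS uv.
have Evu := scaled_avg_vertex_mixing_off vS uS vu.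
have Euu := scaled_avg_vertex_mixing_diag uS.
rewrite nbhd_greenC nbhd_signless_greenC gram_energyC [e v u]e_sym in Evu.
rewrite !M_cst // in Euv Evu Euu.
have du_le := out_deg_edge_le u vS; have du_ge := out_deg_ge0 u.
apply/eqP; apply: contraNT du => dvu.
have cE : 2 * K * c = (e u v)%:R.
  have : (d v - d u) * (2 * K * c - (e u v)%:R) = 0 by lra.
  by move/eqP; rewrite mulf_eq0 subr_eq0 (negbTE dvu) /= subr_eq0 => /eqP.
apply/eqP/gram_energy_eq0/eqP; rewrite eq_le gram_energy_ge0 andbT.
have := sqr_ge0 (d u - al u u); have := sqr_ge0 (d u - be u u).
have : 0 <= d u * (K - d u - (e u v)%:R) by apply: mulr_ge0; lra.
have E2 : 4 * K * d u * c = 2 * d u * (e u v)%:R by rewrite -cE; ring.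
by rewrite E2 in Euu; lra.
Qed.

Lemma uniform_pair u v : u \in S -> v \in S -> u != v -> d u != 0 ->
  [/\ forall t, t \in s -> q t v v = q t u u /\ q t u v ^+ 2 = q t u u ^+ 2,
      d u - al u u = al u v, be u u = al u u, be u v ^+ 2 = al u v ^+ 2 &
      K - d u = (e u v)%:R].
Proof.
move=> uS vS uv du; have vu : v != u by rewrite eq_sym.
have dvu := uniform_out_deg uS vS uv du.
have du_gt0 : 0 < d u by rewrite lt_def du out_deg_ge0.
have Euv := scaled_avg_vertex_mixing_off uS vS uv.
have Euu := scaled_avg_vertex_mixing_diag uS.
have Evv := scaled_avg_vertex_mixing_diag vS.
rewrite !M_cst // dvu in Euv Evv Euu.
have := nbhd_green_le uS vS uv; have := nbhd_green_le vS uS vu; rewrite dvu (nbhd_greenC v u).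
have := norm_nbhd_signless_green u v; have := nbhd_green_ge0 u v.
have := le_trans (ler_norm _) (norm_nbhd_signless_green u u).
have := le_trans (ler_norm _) (norm_nbhd_signless_green v v).
have := gram_energy_CS u v.
have term_ge0 t : t \in s -> 0 <= (K / (K ^+ 2 - t ^+ 2)) ^+ 2 *
    (q t u u ^+ 2 + q t v v ^+ 2 - 2 * q t u v ^+ 2).
  by move=> ts; rewrite mulr_ge0 ?gram_term_ge0 // ltW ?gram_weight_gt0.
have := out_deg_edge_le u vS.
set T := \sum_(t <- s) _ => eK QT bv bu al0 bal av au.
have T0 : 0 <= T by rewrite /T big_seq; apply: sumr_ge0.
have bal2 : be u v ^+ 2 <= al u v ^+ 2.
  by rewrite -(real_normK (num_real (be u v))) lerXn2r ?nnegrE.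
have au2 : al u v ^+ 2 <= (d u - al u u) ^+ 2.
  by rewrite lerXn2r ?nnegrE //; lra.
have av2 : al u v ^+ 2 <= (d u - al v v) ^+ 2.
  by rewrite lerXn2r ?nnegrE //; lra.
have bu2 : (d u - al u u) ^+ 2 <= (d u - be u u) ^+ 2.
  by rewrite lerXn2r ?nnegrE //; lra.
have bv2 : (d u - al v v) ^+ 2 <= (d u - be v v) ^+ 2.
  by rewrite lerXn2r ?nnegrE //; lra.
have eK' : 0 <= d u * (K - d u - (e u v)%:R) by apply: mulr_ge0; lra.
(* This is [4 K d u (M u u + M v v - 2 M u v)], regrouped into nonnegative terms. *)
have sum0 : ((d u - al u u) ^+ 2 - al u v ^+ 2) + ((d u - be u u) ^+ 2 - be u v ^+ 2)
   + ((d u - al v v) ^+ 2 - al u v ^+ 2) + ((d u - be v v) ^+ 2 - be u v ^+ 2)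
   + 2 * T + 4 * (d u * (K - d u - (e u v)%:R)) = 0.
  by rewrite -QT; lra.
have E1 : (d u - al u u) ^+ 2 = al u v ^+ 2 by lra.
have E2 : (d u - be u u) ^+ 2 = (d u - al u u) ^+ 2 by lra.
have E3 : be u v ^+ 2 = al u v ^+ 2 by lra.
have E4 : T = 0 by lra.
have E5 : d u * (K - d u - (e u v)%:R) = 0 by lra.
have sq_inj (x z : R) : 0 <= x -> 0 <= z -> x ^+ 2 = z ^+ 2 -> x = z.
  by move=> x0 z0 /eqP; rewrite eqrXn2 // => /eqP.
split=> //.
- move=> t ts; apply: gram_term_eq0.
  have /eqP := psumr_seq_eq0 term_ge0 E4 ts.
  by rewrite mulf_eq0 gt_eqF ?gram_weight_gt0 //= => /eqP.
- by apply: sq_inj => //; lra.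
- have := sq_inj (d u - be u u) (d u - al u u) _ _ E2 => H.
  by have : d u - be u u = d u - al u u; [apply: H; lra | lra].
move/eqP: E5; rewrite mulf_eq0 (negbTE du) /= subr_eq0 => /eqP //.
Qed.

Lemma uniform_isolated u v : u \in S -> v \in S -> u != v -> d u = 0 ->
  e u v /\ k = 1%N.
Proof.
move=> uS vS uv du.
have := avg_vertex_mixing_isolated uS vS du.
have := avg_vertex_mixing_isolated uS uS du.
rewrite eqxx e_irr (negbTE uv) !M_cst //= => -> E.
have {}E : K = (e u v)%:R by lra.
move: E; rewrite /K => /eqP; rewrite eqr_nat => /eqP.
by move: k_gt0; case: (e u v) => [_ ->|/[swap] ->].
Qed.

(** With a third marked [w], the equal values [al u v] and [al u w] must fit in [d u - al u u], so
    both are 0. Likewise [K - d u] equals each of two adjacency indicators and bounds their sum, so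
    [u] has no marked neighbor. Then [green_full] yields a contradiction. *)
Lemma uniform_card u v : u \in S -> v \in S -> u != v -> d u != 0 -> S = [set u; v].
Proof.
move=> uS vS uv du; apply/finset.setP => w; rewrite !inE.
apply/idP/idP => [wS|/orP[] /eqP -> //]; apply: contraT; rewrite negb_or => /andP[wu wv].
have uw : u != w by rewrite eq_sym.
have [_ Ev _ _ Kv] := uniform_pair uS vS uv du.
have [_ Ew _ _ Kw] := uniform_pair uS wS uw du.
have vP : (v \in S) && (v != u) by rewrite vS eq_sym.
have wP : ((w \in S) && (w != u)) && (w != v) by rewrite wS wu wv.
have sum3 (F : V -> R) : (forall i, 0 <= F i) -> F u + (F v + F w) <= \sum_(i in S) F i.
  move=> F0; rewrite (bigD1 u) //= (bigD1 v) //= (bigD1 w) //= !lerD2l lerDl.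
  by apply: sumr_ge0.
have := sum3 (al u) (nbhd_green_ge0 u); rewrite sum_nbhd_green => al_sum.
have alu : al u u = d u by have := nbhd_green_ge0 u v; lra.
have dK : d u = K.
  have sum_le := sum3 (fun i => (e u i)%:R) (fun i => ler0n _ _).
  have euv0 : 0 <= (e u v)%:R :> R by exact: ler0n.
  rewrite -Kv in euv0; rewrite /= e_irr /= -Kv -Kw add0r in sum_le.
  by have KE := out_degE u; lra.
have sum0 : \sum_(x in nbhd e u :\: S) (1 - a u x) = 0.
  rewrite sumrB -(@sum_out_nbhd u (a u)) => [|x]; last exact: green_in_S.
  by rewrite -/(al u u) alu sumr_const subrr.
suff : v = u by move=> E; move: uv; rewrite E eqxx.
apply: (green_full uS) => // z euz.
have zS : z \notin S.
  apply/negP => zS; have := out_deg_edge_le u zS; rewrite euz dK.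
  by rewrite gerDl leNgt ltr01.
split=> //; have zN : z \in nbhd e u :\: S by rewrite !inE zS euz.
have ge0 x : x \in nbhd e u :\: S -> 0 <= 1 - a u x by rewrite subr_ge0 green_le1.
by have := psumr_eq0P ge0 sum0 zN; lra.
Qed.

Lemma uniform_structure u v : u \in S -> v \in S -> u != v ->
  [/\ #|S| = 2%N, odd_cycle_graph e \/ bipartite_graph e &
      forall w z, w \in S -> z \in S -> nbhd_strongly_cospectral R e S w z].
Proof.
move=> uS vS uv; have [du|du] := eqVneq (d u) 0.
  (* Here [u] and [v] are adjacent of degree 1, so the connected graph is a single edge. *)
  have [euv k1] := uniform_isolated uS vS uv du.
  have N1 x z : e x z -> nbhd e x = [set z].
    move=> exz; apply/esym/eqP; rewrite eqEcard cards1 e_reg k1 leqnn andbT.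
    by rewrite finset.sub1set inE.
  have V_uv x : x \in [set u; v].
    apply: (connected_ind e_conn (P := fun x => x \in [set u; v]) (x0 := u)).
      by rewrite !inE eqxx.
    move=> {}x z exz; have : z \in nbhd e x by rewrite inE.
    rewrite [x \in [set u; v]]in_set2 => + /orP[] /eqP xE; rewrite xE.
      by rewrite (N1 _ _ euv) !inE => ->; rewrite orbT.
    by rewrite (N1 v u) 1?e_sym // !inE => ->.
  have SE : S = [set u; v].
    by apply/finset.setP => x; rewrite V_uv; move: (V_uv x); rewrite !inE => /orP[] /eqP ->.
  split; first by rewrite SE cards2 uv.
    right; exists [set u] => x z exz; move: (V_uv x) (V_uv z) exz; rewrite !inE.
    by move=> /orP[] /eqP -> /orP[] /eqP ->; rewrite ?e_irr // eqxx (eq_sym v) (negbTE uv).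
  (* No vertex is unmarked, so the vectors to compare have no entries. *)
  move=> w z _ _ H P _; left; apply/colP => i.
  by have := V_uv (enum_val i); rewrite -SE; have := enum_valP i; rewrite inE => /negbTE ->.
have SE := uniform_card uS vS uv du.
have [qE alE beE be2 Kd] := uniform_pair uS vS uv du.
have vu : v != u by rewrite eq_sym.
have dv : d v != 0 by rewrite (uniform_out_deg uS vS uv du).
have [_ _ bevE _ _] := uniform_pair vS uS vu dv.
split; first by rewrite SE cards2 uv.
  have [sg sg2 sgE] : exists2 sg : R, sg ^+ 2 = 1 & sg * be u v = al u v.
    move/eqP: be2; rewrite eqf_sqr => /orP[] /eqP ->.
      by exists 1; rewrite ?expr1n ?mul1r.
    by exists (-1); rewrite ?sqrrN ?expr1n // mulrNN mul1r.
  have [B B_alt] := green_almost_bipartite uv SE sg2 beE bevE sgE.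
  apply: (almost_bipartite_cases e_sym e_irr e_conn e_reg SE uv _ B_alt).
  (* If [k = 1] with [u] and [v] adjacent, then [K - d u = 1] gives [d u = 0]. *)
  by move=> euv; apply: contraNneq du => k1; move: Kd; rewrite euv /K k1 /=; lra.
move=> w z wS zS H P P_proj; rewrite /H.
have [t ts ->] := eigen_decomposition_unique (adj_block_sym R S e_sym) AG P_proj.
rewrite -!mulmxA !nbhd_colE //.
have [->|wz] := eqVneq w z; first by left.
suff [qz qwz] : q t z z = q t w w /\ q t w z ^+ 2 = q t w w ^+ 2 by apply: gram_sign.
have dw : d w != 0.
  have [->|wu] := eqVneq w u; first by [].
  by rewrite (uniform_out_deg uS wS _ du) // eq_sym.
by have [qE' _ _ _ _] := uniform_pair wS zS wz dw; exact: qE'.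
Qed.

End Uniform.

(** * Uniformity from the combinatorial structure *)

Section Converse.
Variables (u v : V).
Hypothesis uv : u != v.
Hypothesis SE : S = [set u; v].

Let uS : u \in S. Proof. by rewrite SE !inE eqxx. Qed.
Let vS : v \in S. Proof. by rewrite SE !inE eqxx orbT. Qed.

(** Each unmarked neighbor of [w'] has the color opposite to [w'], so the signs from
    [signless_green_coloring] agree over the whole sum. *)
Lemma coloring_nbhd_green (B : {set V}) w w' :
  (forall x z, e x z -> ~~ ((x \in S) && (z \in S)) -> (x \in B) != (z \in B)) ->
  w \in S -> w' \in S ->
  be w' w = (if (w' \in B) == (w \in B) then 1 else -1) * al w' w.
Proof.
move=> B_alt wS wS'; rewrite /be /al mulr_sumr; apply: eq_bigr => x ewx.
have [xS|xS] := boolP (x \in S).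
  by rewrite signless_green_in_S // green_in_S // mulr0.
rewrite (@signless_green_coloring w B wS) => [|x' z' exz xS' zS'|x' ewx' xS']; last 2 first.
- by apply: B_alt => //; rewrite negb_and xS'.
- by rewrite eq_sym; apply: B_alt => //; rewrite negb_and xS' orbT.
have := B_alt _ _ ewx; rewrite negb_and xS orbT => /(_ isT).
by case: (x \in B); case: (w \in B); case: (w' \in B).
Qed.

(* If the marked vertices of an odd cycle are not adjacent, the two neighbors of
   [u] have different colors in the bipartite graph obtained by deleting [u], so
   that equitability makes [green v] vanish there. *)
Lemma odd_cycle_almost_bipartite : odd_cycle_graph e ->
  exists B : {set V}, forall x z, e x z -> ~~ ((x \in S) && (z \in S)) ->
    (x \in B) != (z \in B).
Proof.
move=> /(odd_cycle_based u)[n [f [n_odd n_gt1 f_bij f0 f_e]]].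
have [g fK gK] := f_bij.
have gu : g u = ord0 by rewrite -f0 fK.
have g_eq x z : (g x == g z) = (x == z) by exact: (inj_eq (can_inj gK)).
have g_edge x z : e x z -> ((g x).+1 == g z :> nat) || ((g z).+1 == g x :> nat) ||
    ((g x == n :> nat) && (g z == ord0)) || ((g z == n :> nat) && (g x == ord0)).
  rewrite -{1}(gK x) -{1}(gK z) f_e !(modn_small (ltn_ord _)).
  have step (i j : 'I_n.+1) : (i.+1 %% n.+1)%N == j -> (i.+1 == j :> nat) || ((i == n :> nat) && (j == ord0)).
    have [ilt|ige] := ltnP i n; first by rewrite modn_small ?ltnS // => ->.
    have -> : i = n :> nat by apply/eqP; rewrite eqn_leq ige -ltnS ltn_ord.
    by rewrite modnn eqxx /= => /eqP j0; apply/orP; right; rewrite -val_eqE /= -j0.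
  by case/orP => /step /orP[] ->; rewrite ?orbT.
have n_even : ~~ odd n by move: n_odd; rewrite /= .
have g0 x : (g x == ord0) = (x == u) by rewrite -gu g_eq.
pose B := [set x | odd (g x)].
have B_alt x z : e x z -> x != u -> z != u -> (x \in B) != (z \in B).
  move=> exz xu zu; have := g_edge _ _ exz; rewrite !g0 (negbTE xu) (negbTE zu) !andbF !orbF.
  by rewrite !inE => /orP[] /eqP <- /=; case: (odd _).
have [euv|neuv] := boolP (e u v).
  have := g_edge _ _ euv; rewrite gu g0 eqxx (eq_sym v u) (negbTE uv) andbT andbF orbF /=.
  rewrite orbF => /orP[/eqP gv|/eqP gv].
    (* Deleting the edge between labels 0 and 1 leaves a path from 1 to the even label [n] and then
       to 0, so the parity of [u] is flipped. *)
    exists [set x | odd (g x) (+) (x == u)] => x z exz xz.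
    have := g_edge _ _ exz; rewrite !g0 !inE.
    have [xu|xu] := eqVneq x u; have [zu|zu] := eqVneq z u; rewrite ?andbT ?andbF ?orbF ?addbF.
    - by rewrite xu zu e_irr in exz.
    - rewrite xu gu /= ?orbF => /orP[/eqP g1|/eqP ->]; last by rewrite (negbTE n_even).
      have zv : z = v by apply/eqP; rewrite -g_eq -val_eqE /= -g1 -gv.
      by rewrite xu zv uS vS in xz.
    - rewrite zu gu /= ?orbF => /orP[/eqP g1|/eqP ->]; last by rewrite (negbTE n_even).
      have xv : x = v by apply/eqP; rewrite -g_eq -val_eqE /= -g1 -gv.
      by rewrite zu xv uS vS in xz.
    by move=> /orP[] /eqP <- /=; case: (odd _).
  (* Here [v] has label [n], and deleting its edge to label 0 leaves a path alternating in
     parity. *)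
  exists B => x z exz xz; have := g_edge _ _ exz; rewrite !g0 !inE.
  have eqv w : (g w == n :> nat) = (w == v) by rewrite -(g_eq w v) -val_eqE /= gv.
  rewrite !eqv; have [xzuv|] := boolP ((x == v) && (z == u) || (z == v) && (x == u)).
    by case/orP: xzuv xz => /andP[/eqP -> /eqP ->]; rewrite uS vS.
  rewrite negb_or => /andP[/negbTE-> /negbTE->]; rewrite !orbF.
  by move=> /orP[] /eqP <- /=; case: (odd _).
have one_lt : (1 < n.+1)%N by exact: ltnW.
pose x1 := f (Ordinal one_lt); pose x2 := f ord_max.
have nbr x : e u x -> x \in nbhd e u :\: S.
  move=> eux; rewrite !inE eux andbT SE !inE negb_or.
  by apply/andP; split; apply: contraTneq eux => ->; rewrite ?e_irr.
have x1N : x1 \in nbhd e u :\: S by apply: nbr; rewrite -f0 f_e /= eqxx.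
have x2N : x2 \in nbhd e u :\: S by apply: nbr; rewrite -f0 f_e /= modnn mod0n eqxx orbT.
have notu x : x \notin S -> x != u by apply: contraNneq => ->.
have bE x : b v x = (if (x \in B) == (v \in B) then -1 else 1) * a v x.
  apply: signless_green_coloring => // [x' z' exz xS zS|x' evx xS].
    by apply: B_alt => //; exact: notu.
  by apply: B_alt; [rewrite e_sym | exact: notu | rewrite eq_sym].
(* The labels 1 and [n] have opposite parities, while equitability gives [a v] and [b v] the same
   values at [x1] and [x2]. Hence [a v] equals its opposite there. *)
have := bE x1; rewrite (signless_green_cst uS vS x1N x2N) bE (green_cst uS vS x1N x2N).
rewrite !inE /x1 /x2 !fK /= (negbTE n_even) => E.
have := green_nonzero uv SE neuv e_irr x2N; suff -> : a v x2 = 0 by rewrite eqxx.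
by move: E; rewrite /x2; case: (odd _) => /=; lra.
Qed.

(** Strong cospectrality equates the out-degrees and the energies [Q], and the coloring gives
    [be = al] on the diagonal and equal squares off it. Together with [al w u + al w v = d w] this
    makes the four mixing identities coincide. *)
Lemma uniform_of_structure :
  odd_cycle_graph e \/ bipartite_graph e -> nbhd_strongly_cospectral R e S u v ->
  exists c, forall w z, w \in S -> z \in S -> M w z = c.
Proof.
move=> cyc_bip nsc; have vu : v != u by rewrite eq_sym.
have [B B_alt] : exists B : {set V}, forall x z, e x z ->
    ~~ ((x \in S) && (z \in S)) -> (x \in B) != (z \in B).
  case: cyc_bip => [|[B HB]]; first exact: odd_cycle_almost_bipartite.
  by exists B => x z exz _; exact: HB.
have qE t : t \in s -> q t v v = q t u u /\ q t u v ^+ 2 = q t u u ^+ 2.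
  move=> ts; apply: sign_gram.
  have := nsc _ (eigen_decomposition_eigenprojection (adj_block_sym R S e_sym) AG ts).
  by rewrite -!mulmxA !nbhd_colE.
have dvu : d v = d u.
  by rewrite -!sum_gram big_seq [RHS]big_seq; apply: eq_bigr => t /qE[].
have Qv : Q v v = Q u u.
  by rewrite /Q big_seq [RHS]big_seq; apply: eq_bigr => t /qE[->].
have Quv : Q u v = Q u u.
  by rewrite /Q big_seq [RHS]big_seq; apply: eq_bigr => t /qE[_ ->].
have alu := nbhd_green_two uv SE u; have alv := nbhd_green_two uv SE v.
rewrite dvu (nbhd_greenC v u) in alv.
have beu := coloring_nbhd_green B_alt uS uS; have bev := coloring_nbhd_green B_alt vS vS.
rewrite eqxx mul1r in beu; rewrite eqxx mul1r in bev.
have beuv : be u v ^+ 2 = al u v ^+ 2.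
  rewrite (coloring_nbhd_green B_alt vS uS) exprMn.
  by case: ifP; rewrite ?sqrrN expr1n mul1r.
have Kd : K - d u = (e u v)%:R.
  by rewrite (out_degE u) (sum_two uv SE) e_irr add0r addrC addKr.
have Kneq0 : 4 * K != 0 by rewrite mulf_neq0 // gt_eqF.
suff [Muu Mvv Mvu] : [/\ M u u = M u v, M v v = M u v & M v u = M u v].
  have two x : x \in S -> x = u \/ x = v.
    by rewrite SE !inE => /orP[] /eqP ->; [left | right].
  exists (M u v) => w z /two[] -> /two[] ->.
  - exact Muu.
  - exact (erefl (M u v)).
  - exact Mvu.
  - exact Mvv.
have [du|du] := eqVneq (d u) 0.
  have dv : d v = 0 by rewrite dvu.
  have := avg_vertex_mixing_isolated uS vS du.
  have := avg_vertex_mixing_isolated uS uS du.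
  have := avg_vertex_mixing_isolated vS vS dv.
  have := avg_vertex_mixing_isolated vS uS dv.
  rewrite !eqxx !e_irr (negbTE uv) (negbTE vu) /= [e v u]e_sym.
  move: Kd; rewrite du subr0 => <- Evu Evv Euu Euv.
  split; apply: (mulfI Kneq0); [apply: (etrans Euu) | apply: (etrans Evv) | apply: (etrans Evu)];
  apply: (etrans _ (esym Euv)); ring.
have dKneq0 : 4 * K * d u != 0 by rewrite mulf_neq0.
have Euv := scaled_avg_vertex_mixing_off uS vS uv.
have Evu := scaled_avg_vertex_mixing_off vS uS vu.
have Euu := scaled_avg_vertex_mixing_diag uS.
have Evv := scaled_avg_vertex_mixing_diag vS.
rewrite nbhd_greenC nbhd_signless_greenC gram_energyC [e v u]e_sym in Evu.
rewrite dvu in Evu Evv.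
have du_al : d u - al u u = al u v by rewrite -alu addrC addKr.
have dv_al : d u - al v v = al u v by rewrite -alv addrK.
rewrite beu Quv Kd du_al in Euu Euv; rewrite bev Qv Kd dv_al in Evv.
rewrite beuv Quv in Euv Evu.
split; apply: (mulfI dKneq0); [apply: (etrans Euu) | apply: (etrans Evv) | apply: (etrans Evu)];
  apply: (etrans _ (esym Euv)); ring.
Qed.

End Converse.

End MarkedGraph.

Lemma mx_on_eq_const (R : realType) (I : finType) (P : {set I}) (f : I -> I -> R) (c : R) :
  mx_on P P f = const_mx c <-> forall x y, x \in P -> y \in P -> f x y = c.
Proof.
split=> [fc x y xP yP|fc].
  have := congr1 (fun A : 'M[R]_(#|P|, #|P|) => A (enum_rank_in xP x) (enum_rank_in yP y)) fc.
  by rewrite !mxE !enum_rankK_in.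
by apply/matrixP => i j; rewrite !mxE; apply: fc; exact: enum_valP.
Qed.

Theorem theorem8p4 (R : realType) (V : finType) (e : rel V) (k : nat)
    (S : {set V})
    (e_sym : symmetric e) (e_irr : irreflexive e)
    (e_reg : regular_graph e k) (e_conn : connected_graph e)
    (S_ge2 : (2 <= #|S|)%N)
    (S_equit : walk_equitable_nbhds e S) :
  (exists c : R, mx_on S S (avg_vertex_mixing R e k S) = const_mx c) <->
  [/\ #|S| = 2%N,
      odd_cycle_graph e \/ bipartite_graph e &
      forall a b : V, a \in S -> b \in S ->
        nbhd_strongly_cospectral R e S a b].
Proof.
have [u [v [uS vS uv]]] : exists u v, [/\ u \in S, v \in S & u != v].
  by have /card_gt1P[u [v H]] := S_ge2; exists u, v.
(* A graph of degree 0 has no edges, so connectedness would give [v = u]. *)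
have k_gt0 : (0 < k)%N.
  rewrite lt0n; apply: contraNneq uv => k0; apply/eqP/esym.
  apply: (connected_ind e_conn (P := fun x => x = u) (x0 := u)) => // x z exz _.
  have : z \in nbhd e x by rewrite inE.
  by have /eqP := e_reg x; rewrite k0 cards_eq0 => /eqP ->; rewrite inE.
have [s [G [AG G_closed]]] :=
  real_sym_eigen_decomposition (adj_block_sym R S e_sym).
split=> [[c /mx_on_eq_const M_cst]|[S2 cyc_bip nsc]].
  exact: (uniform_structure e_sym e_reg e_conn k_gt0 uS S_equit AG G_closed e_irr M_cst uS vS uv).
have SE : S = [set u; v].
  apply/esym/eqP; rewrite eqEcard S2 cards2 uv leqnn andbT.
  by apply/fintype.subsetP => x; rewrite !inE => /orP[] /eqP ->.
have [c M_cst] := uniform_of_structure e_sym e_reg e_conn k_gt0 uS S_equit AG G_closed e_irr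
  uv SE cyc_bip (nsc _ _ uS vS).
by exists c; apply/mx_on_eq_const.
Qed.
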